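(* Let $\alpha>0$. A stationary policy $\phi$ is discount-optimal within the class of the policies that never switch off the running system if and only if for all $i=0,1,\ldots$, $$\phi(i,0)=\begin{cases}1, & \text{if } i>A(\alpha),\\ 0, & \text{if } i<A(\alpha),\end{cases}$$ where $$A(\alpha)=\frac{(\mu+\alpha)(c+\alpha s_1)}{h\mu}.$$
   Context: Model. Consider an $M/M/\infty$ queue: Poisson arrivals with rate $\lambda>0$, infinitely many independent identical servers, exponential service times with rate $\mu>0$. The entire service capacity can be switched on or off: when it is off nobody is served, when it is on every customer in the system is in service. Costs: holding cost $h>0$ per customer per unit time; running cost $c>0$ per unit time while the system is on (0 while off); start-up cost $s_1\ge 0$ each time the system is switched on; shut-down cost $s_0\ge 0$ each time it is switched off; $s_0+s_1>0$. This is a continuous-time Markov decision process with state space $Z=\mathbb{N}\times\{0,1\}$, $\mathbb{N}=\{0,1,\ldots\}$. In state $(i,\delta)$, $i$ is the number of customers in the system and $\delta$ is the status (1 = on, 0 = off) of the system at the last jump epoch, i.e. prior to the current decision; jump epochs are arrival and departure epochs. In every state the available actions are $\{0,1\}$ (0: system off, 1: system on). Under action $a$ the process moves from $(i,\delta)$ to $(j,a)$, $j\ne i$, with rate $q(j|i,a)$, where $q(j|i,a)=\lambda$ if $j=i+1$, $q(j|i,a)=i\mu$ if $i>0,\ a=1,\ j=i-1$, and $q(j|i,a)=0$ otherwise. A general policy may be time-dependent and history-dependent (actions are a predictable function of time and history). A stationary policy is a function $\phi:Z\to \{0,1\}$: at each jump epoch (and at time 0), in state $z$, action $\phi(z)$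 is chosen and kept until the next jump. Discounted costs. For a policy $\pi$ and initial state $z=(i,\delta)$, let $x_t$ be the number of customers at time $t$, $a(t)$ the action at time $t$ (left-continuous, $a(0)=\delta$), $0\le t_1<t_2<\cdots$ the times at which the system is switched on or off, and $N(t)$ the number of switchings up to time $t$. The cumulative cost is $C(t)=\int_0^t (h x_s+c\,a(s))\,ds+\sum_{n=1}^{N(t)} s_{a(t_n+)}|a(t_n+)-a(t_n)|$. For $\alpha>0$, $V_\alpha^\pi(z)=E^\pi_z\int_0^\infty e^{-\alpha t}dC(t)$, with $V_\alpha^\pi(z)=\infty$ if $N(t)=\infty$ with positive probability for some $t<\infty$. The class of policies that never switch the running system off is the class of all policies for the sub-model in which the action sets at the states $(i,1)$, $i=0,1,\ldots$, are reduced to $\{1\}$; in particular a stationary policy $\phi$ in this class has $\phi(i,1)=1$ for all $i$. $U_\alpha(i,\delta)$ denotes the infimum of $V^\pi_\alpha(i,\delta)$ over all policies $\pi$ in this class. A policy $\phi$ is discount-optimal within this class if it belongs to the class and $V_\alpha^\phi(z)=U_\alpha(z)$ for all $z\in Z$. (In the claim, $\phi$ is a stationary policy in this class.) *)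

(* Defs.v *)
From HB Require Import structures.
From mathcomp Require Import all_boot all_order all_algebra.
From mathcomp Require Import all_classical all_reals all_analysis.
Set Implicit Arguments.
Unset Strict Implicit.
Unset Printing Implicit Defensive.
Import Order.TTheory GRing.Theory Num.Theory.
Import numFieldNormedType.Exports.
Local Open Scope classical_set_scope.
Local Open Scope ring_scope.

Record queue (R : realType) := Queue {
  arr_rate : R ;
  srv_rate : R ;
  hold_cost : R ;
  run_cost : R ;
  start_cost : R ;
  shut_cost : R ;
  arr_rate_gt0 : 0 < arr_rate ;
  srv_rate_gt0 : 0 < srv_rate ;
  hold_cost_gt0 : 0 < hold_cost ;
  run_cost_gt0 : 0 < run_cost ;
  start_cost_ge0 : 0 <= start_cost ;
  shut_cost_ge0 : 0 <= shut_cost ;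
  switch_costs_gt0 : 0 < shut_cost + start_cost }.

(* (i, delta): number of customers, and status (true = on) of the system at the
   last jump epoch, prior to the current decision. *)
Definition state := (nat * bool)%type.

Definition rate (R : realType) (q : queue R) (i : nat) (a : bool) (j : nat) : R :=
  if j == i.+1 then arr_rate q
  else if [&& (0 < i)%N, a & j == i.-1] then i%:R * srv_rate q
  else 0.

(* The sum over all j != i: [rate q i a j] vanishes for j = i and j > i.+1. *)
Definition exit_rate (R : realType) (q : queue R) (i : nat) (a : bool) : R :=
  \sum_(j < i.+2) rate q i a j.

Definition switch_cost (R : realType) (q : queue R) (a : bool) : R :=
  if a then start_cost q else shut_cost q.

(* ((t_0, z_0), ..., (t_n, z_n)): the jump epochs, with t_0 = 0, and the states
   entered at them. *)
Definition hist (R : realType) (n : nat) := n.+1.-tuple (R * state).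

Definition last_state (R : realType) (n : nat) (h : hist R n) : state :=
  (tnth h ord_max).2.

(* [p n h s] is the action at the time t_n + s, for 0 < s <= t_(n+1) - t_n, given
   the history h up to the n-th jump epoch; the action at t_(n+1) itself is still
   chosen from h (predictability). *)
Definition policy (R : realType) := forall n : nat, hist R n -> R -> bool.

Definition is_policy (R : realType) (p : policy R) : Prop :=
  (forall n, measurable_fun setT (fun x : hist R n * R => p n x.1 x.2)) /\
  (forall n (h : hist R n) (s : R), 0 < s ->
     \forall u \near s^'-, p n h u = p n h s).

Definition stationary (R : realType) (phi : state -> bool) : policy R :=
  fun n h _ => phi (last_state h).

(* The action sets at the states (i, 1) are reduced to {1}. *)
Definition never_off (R : realType) (p : policy R) : Prop :=
  forall n (h : hist R n) (s : R), 0 < s -> (last_state h).2 -> p n h s.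

(* Conditional probability that the sojourn time in a state with i customers,
   under the action b s at elapsed time s, lies in B and that the next state
   is (j, a). *)
Definition jump_kernel (R : realType) (q : queue R) (i : nat) (b : R -> bool)
    (B : set R) (j : nat) (a : bool) : \bar R :=
  (\int[lebesgue_measure]_(s in B `&` `]0%R, +oo[)
     ((b s == a)%:R * rate q i (b s) j *
      expR (- \int[lebesgue_measure]_(u in `]0, s]) exit_rate q i (b u))%R)%:E)%E.

Section process.
Context (R : realType) (d : measure_display) (Omega : measurableType d).
(* jump epochs and states entered at them *)
Variables (T : nat -> Omega -> R) (Z : nat -> Omega -> state).

Definition history (n : nat) (w : Omega) : hist R n :=
  [tuple (T k w, Z k w) | k < n.+1].

(* P is the law of the process under the policy p from the initial state z. This
   determines the law of the sequence (T n, Z n), which exists on the space of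
   trajectories by the Ionescu-Tulcea theorem. Since the exit rates are at least
   arr_rate q > 0, almost surely every jump epoch is followed by another one; the
   jump epochs tend to infinity because departures never outnumber the initial
   customers and the arrivals. *)
Definition policy_law (q : queue R) (p : policy R) (z : state)
    (P : probability Omega R) : Prop :=
  P [set w | T 0 w = 0 /\ Z 0 w = z] = 1%E /\
  forall n (A : set (hist R n)) (B : set R) (j : nat) (a : bool),
    measurable A -> measurable B ->
    P [set w | [/\ A (history n w), B (T n.+1 w - T n w) & Z n.+1 w = (j, a)]] =
    (\int[P]_(w in [set w | A (history n w)])
       jump_kernel q (Z n w).1 (p n (history n w)) B j a)%E.

Definition customers (w : Omega) (t : R) : nat :=
  (Z (xget 0%N [set n | T n w <= t < T n.+1 w]) w).1.

(* left-continuous *)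
Definition action (p : policy R) (w : Omega) (t : R) : bool :=
  if 0 < t then
    let n := xget 0%N [set n | T n w < t <= T n.+1 w] in
    p n (history n w) (t - T n w)
  else (Z 0 w).2.

(* The right limit of the action at t, and false where this limit does not exist;
   there are then infinitely many switchings on every right neighborhood of t. *)
Definition action_right (p : policy R) (w : Omega) (t : R) : bool :=
  `[< \forall u \near t^'+, action p w u >].

Definition switchings (p : policy R) (w : Omega) : set R :=
  [set t | 0 <= t /\ action_right p w t != action p w t].

(* The integral of exp (- alpha t) with respect to dC(t): the absolutely
   continuous part, and the atoms of C at the switching times. *)
Definition path_cost (q : queue R) (alpha : R) (p : policy R) (w : Omega) : \bar R :=
  (\int[lebesgue_measure]_(t in `[0%R, +oo[)
     (expR (- (alpha * t)) * (hold_cost q * (customers w t)%:R +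
                              run_cost q * (action p w t)%:R))%:E +
   \esum_(t in switchings p w)
     (expR (- (alpha * t)) * switch_cost q (action_right p w t))%:E)%E.

Variable P : policy R -> state -> probability Omega R.

Definition discounted_cost (q : queue R) (alpha : R) (p : policy R) (z : state)
    : \bar R :=
  if `[< forall t : R, 0 <= t ->
         {ae P p z, forall w, finite_set (switchings p w `&` `[0, t])} >]
  then (\int[P p z]_w path_cost q alpha p w)%E
  else +oo%E.

Definition never_off_value (q : queue R) (alpha : R) (z : state) : \bar R :=
  ereal_inf [set discounted_cost q alpha p z |
             p in [set p | is_policy p /\ never_off p]].

Definition never_off_optimal (q : queue R) (alpha : R) (p : policy R) : Prop :=
  [/\ is_policy p, never_off p &
      forall z, discounted_cost q alpha p z = never_off_value q alpha z].

End process.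

Definition threshold (R : realType) (q : queue R) (alpha : R) : R :=
  (srv_rate q + alpha) * (run_cost q + alpha * start_cost q) /
  (hold_cost q * srv_rate q).

(* Main.v *)
Require Import Defs.
From HB Require Import structures.
From mathcomp Require Import all_boot all_order all_algebra.
From mathcomp Require Import all_classical all_reals all_analysis.
From mathcomp Require Import measurable_realfun ring lra.
Set Implicit Arguments.
Unset Strict Implicit.
Unset Printing Implicit Defensive.
Import Order.TTheory GRing.Theory Num.Theory.
Import numFieldNormedType.Exports.
Local Open Scope classical_set_scope.
Local Open Scope ring_scope.

(** While the system is off no customer leaves, and once it is on it stays on, so
    that the only decision that matters is the moment of the start-up. With the
    system on, [i] customers cost [on_value i], an affine function of [i]. Waiting in
    state [(i, false)] instead of starting at once saves, per unit of time,
    [waiting_gain i = alpha s1 + c - h i mu / (mu + alpha)], which is positive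
    exactly when [i] is below the threshold. Since the number of waiting customers
    only grows, the optimal stopping problem is monotone: one waits as long as the
    instantaneous gain is positive, and the discounted sum [waiting_value i] of the
    positive gains at [i], [i + 1], ... is what waiting saves. This yields the value
    function [value].

    A policy may also switch the system on and off again within one sojourn, since
    the running system is recognised only at jump epochs. The first start-up within a
    sojourn costs [s1], and after it nothing is charged for further switchings in the
    lower bound; the Bellman inequalities [value_subsolution] still hold for this
    relaxation ([subsolution_flow]), because [value (i, false) <= s1 + value (i, true)].

    The costs are accumulated sojourn by sojourn. A start-up payment at time [r] within
    a sojourn of length [t] is replaced by interest at rate [alpha * s1] on the rest of the
    sojourn and a payment of [s1] at its end: this has the same discounted value, and it
    turns all costs into a running cost plus a terminal payment at the next jump. For
    such costs the jump kernel gives the conditional expectation over one sojourn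
    ([expectation_sojourn]); it is compared with the present value of the state by
    means of the identity that [exp (- J)], for a cumulated hazard [J] with rate [r], has
    tail integral [\int_u^oo r exp (- J) = exp (- J u)] ([survival_tail]).
    Iterating over the sojourns, the expected cost of the first [n] sojourns plus the
    expected discounted value at the [n]-th jump epoch is nondecreasing in [n], and
    constant for a threshold policy. The discounted value at the [n]-th epoch tends to
    0 by a quadratic Lyapunov function ([discounted_count1_cvg0]), which also shows
    that the epochs tend to infinity ([series_discount_finite_ae]).

    The expected cost of [n] sojourns is a lower bound of the cost of every policy
    ([cost_upto_le_path_cost]), and it exhausts the cost of a stationary policy
    ([stationary_path_cost_le]). So [value] is a lower bound for all policies, attained
    by all threshold policies. If a stationary policy takes a wrong decision in
    [(i, false)], then the first step of the iteration already gives a strictly larger lower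
    bound for its cost ([wrong_decision_not_optimal]). *)

(** * Survival functions of bounded measurable hazard rates *)

(** Cutting the interval from [a] to [b] into [n] equal pieces bounds the total increment by
    [K (b - a) ^ 2 / n], for every [n]. *)
Lemma quadratic_increments_cst (R : realType) (f : R -> R) (K a b : R) :
  (forall s t, a <= s -> s <= t -> `|f t - f s| <= K * (t - s) ^+ 2) ->
  a <= b -> f b = f a.
Proof.
move=> fK ab.
have step n : `|f b - f a| <= K * (b - a) ^+ 2 / n.+1%:R.
  pose d := (b - a) / n.+1%:R.
  have d0 : 0 <= d by rewrite divr_ge0// subr_ge0.
  have nd : n.+1%:R * d = b - a by rewrite /d mulrC divfK// pnatr_eq0.
  have H k : `|f (a + k%:R * d) - f a| <= k%:R * (K * d ^+ 2).
    elim: k => [|k IH]; first by rewrite !mul0r addr0 subrr normr0.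
    have -> : f (a + k.+1%:R * d) - f a =
       (f (a + k.+1%:R * d) - f (a + k%:R * d)) + (f (a + k%:R * d) - f a) by ring.
    have -> : k.+1%:R * (K * d ^+ 2) = K * d ^+ 2 + k%:R * (K * d ^+ 2).
      by rewrite -natr1; ring.
    rewrite (le_trans (ler_normD _ _))// lerD//.
    have -> : K * d ^+ 2 = K * ((a + k.+1%:R * d) - (a + k%:R * d)) ^+ 2.
      by rewrite -natr1; ring.
    apply: fK; first by rewrite lerDl mulr_ge0.
    by rewrite lerD2l ler_wpM2r// ler_nat.
  have -> : K * (b - a) ^+ 2 / n.+1%:R = n.+1%:R * (K * d ^+ 2).
    have : n.+1%:R != 0 :> R by rewrite pnatr_eq0.
    by rewrite -nd; move: n.+1%:R => N N0; field.
  have := H n.+1; rewrite nd (_ : a + (b - a) = b)//; ring.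
apply/eqP; rewrite -subr_eq0 -normr_eq0 eq_le normr_ge0 andbT.
apply/ler_addgt0Pl => e e0; rewrite addr0.
pose M := K * (b - a) ^+ 2.
have [n nM] : exists n, M / e < n%:R.
  by exists (Num.trunc (M / e)).+1; exact: truncnS_gt.
apply: (le_trans (step n)); rewrite -/M ler_pdivrMr// mulrC -ler_pdivrMr//.
by rewrite (le_trans (ltW nM))// ler_nat.
Qed.

(** When the cumulated hazard grows from [a] to [a + m], the decrement of
    [exp (- hazard)] and its putative integral [D] both lie between [exp (- (a + m)) m]
    and [exp (- a) m], and these bounds differ by at most [m ^ 2]. *)
Lemma exp_increment_error (R : realType) (a m D b : R) :
  0 <= a -> 0 <= m -> m <= b ->
  D <= expR (- a) * m -> expR (- (a + m)) * m <= D ->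
  `|expR (- (a + m)) - expR (- a) + D| <= b ^+ 2.
Proof.
move=> a0 m0 mb; rewrite opprD expRD.
have em : expR m * expR (- m) = 1 by rewrite -expRD subrr expR0.
have := expR_ge1Dx m; have := expR_ge1Dx (- m).
have : expR (- a) <= 1 by rewrite -expR0 ler_expR oppr_le0.
have := expR_gt0 (- m); have := expR_gt0 (- a).
have mmb : m ^+ 2 <= b ^+ 2 by rewrite ler_sqr ?nnegrE// (le_trans m0).
move: (expR (- a)) (expR (- m)) (expR m) em => A E F FE A0 E0 A1 E1 F1 D1 D2.
have E2 : E * m <= 1 - E.
  by rewrite -[X in _ <= X - _]FE; nra.
rewrite ler_norml; apply/andP; split; nra.
Qed.

Definition hazard (R : realType) (r : R -> R) (s : R) : R :=
  \int[lebesgue_measure]_(u in `]0, s]) r u.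

Section survival.
Context (R : realType).
Notation mu := (@lebesgue_measure R).
Variables (r : R -> R) (c C : R).
Hypotheses (mr : measurable_fun setT r) (c0 : 0 < c).
Hypotheses (cr : forall s, c <= r s) (rC : forall s, r s <= C).

Lemma hazard_rate_ge0 s : 0 <= r s.
Proof. exact: le_trans (ltW c0) (cr s). Qed.

Lemma bounded_itv_integrable (f : R -> R) (M s t : R) b1 b2 :
  measurable_fun setT f -> (forall u, `|f u| <= M) ->
  mu.-integrable [set` Interval (BSide b1 s) (BSide b2 t)] (EFin \o f).
Proof.
move=> mf fM; apply: measurable_bounded_integrable => //=.
- rewrite lebesgue_measure_itv//=; case: ifPn => // _; by rewrite -EFinB ltry.
- exact: measurable_funTS.
- exists M; split; first by rewrite num_real.
  move=> x Mx y _; apply: (le_trans (fM _)); exact: ltW.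
Qed.

Local Notation J := (hazard r).

Lemma rate_integrable s t b1 b2 :
  mu.-integrable [set` Interval (BSide b1 s) (BSide b2 t)] (EFin \o r).
Proof.
apply: (@bounded_itv_integrable _ C) => // u.
by rewrite ger0_norm// hazard_rate_ge0.
Qed.

Lemma hazardB s t : 0 <= s -> s <= t ->
  J t - J s = \int[mu]_(u in `]s, t]) r u.
Proof. by move=> s0 st; apply: Rintegral_itvB; rewrite ?bnd_simp//; exact: rate_integrable. Qed.

Lemma Rintegral_cst_itv s t (k : R) : s <= t -> \int[mu]_(u in `]s, t]) k = k * (t - s).
Proof.
move=> st; rewrite Rintegral_cst//= lebesgue_measure_itv/= lte_fin.
case: ifPn => [_|]; first by [].
rewrite -leNgt => ts /=; have -> : s = t by apply/le_anti/andP.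
by rewrite subrr.
Qed.

Lemma cst_itv_integrable s t (k : R) b1 b2 :
  mu.-integrable [set` Interval (BSide b1 s) (BSide b2 t)] (EFin \o cst k).
Proof. exact: (@bounded_itv_integrable _ `|k|). Qed.

Lemma hazard_lb s t : 0 <= s -> s <= t -> c * (t - s) <= J t - J s.
Proof. by move=> s0 st; rewrite hazardB// -Rintegral_cst_itv// le_Rintegral//;
  [exact: cst_itv_integrable | exact: rate_integrable]. Qed.

Lemma hazard_ub s t : 0 <= s -> s <= t -> J t - J s <= C * (t - s).
Proof. by move=> s0 st; rewrite hazardB// -Rintegral_cst_itv// le_Rintegral//;
  [exact: rate_integrable | exact: cst_itv_integrable]. Qed.

Lemma hazard_neg s : s <= 0 -> J s = 0.
Proof. by move=> s0; rewrite /hazard set_itv_ge ?bnd_simp -?leNgt// Rintegral_set0. Qed.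

Lemma hazard_ge0 s : 0 <= J s.
Proof. by apply: Rintegral_ge0 => u _; exact: hazard_rate_ge0. Qed.

Lemma hazard_nd : {homo J : s t / s <= t}.
Proof.
move=> s t st; have [s0|s0] := leP s 0.
  by rewrite hazard_neg// hazard_ge0.
rewrite -subr_ge0 (le_trans _ (hazard_lb _ st))//; last exact: ltW.
by rewrite mulr_ge0 ?(ltW c0)// subr_ge0.
Qed.

Lemma survival_measurable : measurable_fun setT (fun s => expR (- J s)).
Proof.
apply: nonincreasing_measurable; first exact: measurableT.
move=> s t st.
by rewrite ler_expR lerN2 hazard_nd.
Qed.

Local Notation g := (fun s => r s * expR (- J s)).
Lemma jump_density_measurable : measurable_fun setT g.
Proof. by apply: measurable_funM => //; exact: survival_measurable. Qed.
Lemma jump_density_ge0 s : 0 <= r s * expR (- J s).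
Proof. by rewrite mulr_ge0 ?expR_ge0// hazard_rate_ge0. Qed.
Lemma jump_density_bounded s : `|r s * expR (- J s)| <= C.
Proof.
rewrite ger0_norm ?jump_density_ge0// (le_trans _ (rC s))// ger_pMr ?(lt_le_trans c0)//.
by rewrite -expR0 ler_expR oppr_le0 hazard_ge0.
Qed.
Lemma jump_density_integrable s t b1 b2 :
  mu.-integrable [set` Interval (BSide b1 s) (BSide b2 t)] (EFin \o g).
Proof.
apply: (@bounded_itv_integrable _ C); first exact: jump_density_measurable.
exact: jump_density_bounded.
Qed.

(** The rate is only measurable, so that [exp (- J)] may fail to be differentiable at
    many points; but the error of the fundamental theorem of calculus on an interval is
    quadratic in its length, and hence vanishes after subdivision. *)
Lemma survival_decrement s t : 0 <= s -> s <= t ->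
  \int[mu]_(u in `]s, t]) (r u * expR (- J u)) = expR (- J s) - expR (- J t).
Proof.
move=> s0 st.
pose f x := expR (- J x) + \int[mu]_(u in `]0, x]) (r u * expR (- J u)).
have C0 : 0 <= C by apply: (le_trans (ltW c0)); apply: le_trans (rC 0).
suff ff : f t = f s.
  have := @Rintegral_itvB _ g (BRight 0) (BRight t) s (jump_density_integrable _ _ _ _).
  rewrite !bnd_simp => <-//; move: ff; rewrite /f => {f} ff.
  by apply/eqP; rewrite subr_eq addrAC eq_sym subr_eq -ff addrC.
(* C bounds the rate, so that the hazard grows by at most C (y - x) on ]x, y]. *)
apply: (@quadratic_increments_cst _ f (C ^+ 2) s t) => // x y sx xy.
have x0 : 0 <= x by exact: le_trans sx.
have -> : f y - f x = expR (- J y) - expR (- J x) + \int[mu]_(u in `]x, y]) (r u * expR (- J u)).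
  rewrite -(@Rintegral_itvB _ g (BRight 0) (BRight y) x) ?bnd_simp//; last exact: jump_density_integrable.
  by rewrite /f opprD addrACA.
move=> {f}; have [m mJ] : exists m, m = J y - J x by eexists.
have m0 : 0 <= m by rewrite mJ subr_ge0 hazard_nd.
have mC : m <= C * (y - x) by rewrite mJ; exact: hazard_ub.
have mE : m = \int[mu]_(u in `]x, y]) r u by rewrite mJ -hazardB.
move DE : (\int[mu]_(u in `]x, y]) (r u * expR (- J u))) => D.
have eyx : expR (- J y) <= expR (- J x) by rewrite ler_expR lerN2 hazard_nd.
have D1 : D <= expR (- J x) * m.
  rewrite -DE mE -RintegralZl//=; last exact: rate_integrable.
  apply: le_Rintegral => //.
    exact: jump_density_integrable.
    by apply: (@integrableZl _ _ _ mu _ _ _ (EFin \o r)) => //; exact: rate_integrable.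
  move=> u; rewrite /= in_itv/= => /andP[xu uy].
  rewrite mulrC; apply: ler_wpM2r; first exact: hazard_rate_ge0.
  by rewrite ler_expR lerN2; apply: hazard_nd; exact: ltW.
have D2 : expR (- J y) * m <= D.
  rewrite -DE mE -RintegralZl//=; last exact: rate_integrable.
  apply: le_Rintegral => //.
    by apply: (@integrableZl _ _ _ mu _ _ _ (EFin \o r)) => //; exact: rate_integrable.
    exact: jump_density_integrable.
  move=> u; rewrite /= in_itv/= => /andP[xu uy].
  rewrite mulrC; apply: ler_wpM2l; first exact: hazard_rate_ge0.
  by rewrite ler_expR lerN2; apply: hazard_nd.
have Jy : J y = J x + m by rewrite mJ addrC subrK.
rewrite Jy in D2 *; rewrite -exprMn.
by apply: exp_increment_error => //; exact: hazard_ge0.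
Qed.

End survival.

Section survival_tail.
Local Open Scope ereal_scope.
Context (R : realType).
Notation mu := (@lebesgue_measure R).
Variables (r : R -> R) (c C : R).
Hypotheses (mr : measurable_fun setT r) (c0 : (0 < c)%R).
Hypotheses (cr : forall s, (c <= r s)%R) (rC : forall s, (r s <= C)%R).
Local Notation J := (hazard r).

Lemma survival_cvg0 (u : R) : (0 <= u)%R ->
  (fun n => expR (- J (u + n%:R))) @ \oo --> (0 : R)%R.
Proof.
move=> u0; apply: (@squeeze_cvgr _ _ _ _ (cst 0%R) (fun n => expR (- c) ^+ n)%R).
- near=> n; rewrite expR_ge0/= -expRM_natr ler_expR mulNr lerN2.
  have un : (u <= u + n%:R)%R by rewrite lerDl.
  have := hazard_lb mr c0 cr rC u0 un; rewrite addrC addKr => H.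
  by rewrite (le_trans H)// gerBl (hazard_ge0 c0 cr).
- exact: cvg_cst.
- by apply: cvg_expr; rewrite ger0_norm ?expR_ge0// -expR0 ltr_expR oppr_lt0.
Unshelve. all: by end_near.
Qed.

(** The next jump occurs eventually, since the hazard grows at least linearly. *)
Lemma survival_tail (u : R) : (0 <= u)%R ->
  \int[mu]_(s in `]u, +oo[) (r s * expR (- J s))%:E = (expR (- J u))%:E.
Proof.
move=> u0.
have mg := jump_density_measurable mr c0 cr rC.
have -> : `]u, +oo[%classic = \bigcup_n `]u, (u + n%:R)%R]%classic.
  apply/seteqP; split => [s|s [n _]] /=; rewrite !in_itv/= ?andbT.
    move=> us; exists (Num.trunc (s - u)).+1 => //=.
    by rewrite in_itv/= us -lerBlDl ltW// truncnS_gt.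
  by case/andP.
have e n : \int[mu]_(s in `]u, (u + n%:R)%R]) (r s * expR (- J s))%:E =
   (expR (- J u) - expR (- J (u + n%:R)))%:E.
  rewrite -(@survival_decrement _ r c C)// ?lerDl//.
  rewrite /Rintegral fineK//; apply: integrable_fin_num => //.
  exact: (jump_density_integrable mr c0 cr rC).
have H : \int[mu]_(s in `]u, (u + n%:R)%R]) (r s * expR (- J s))%:E @[n --> \oo]
    --> \int[mu]_(s in \bigcup_n `]u, (u + n%:R)%R]%classic) (r s * expR (- J s))%:E.
  apply: ge0_nondecreasing_set_cvg_integral => //.
  - by move=> m n mn; apply/subsetPset/subset_itvl; rewrite bnd_simp lerD2l ler_nat.
  - by move=> n; apply/measurable_EFinP/measurable_funTS.
  - by move=> n s _; rewrite lee_fin (jump_density_ge0 c0 cr).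
move: H; under eq_fun do rewrite e; move=> H.
apply: (cvg_unique _ H) => //.
apply: cvg_EFin; first by near=> n.
rewrite -[X in _ --> X]subr0.
by apply: cvgB; [exact: cvg_cst|exact: survival_cvg0].
Unshelve. all: by end_near. Qed.

(** Tonelli: what is spent at time [u] is spent if and only if the jump comes after
    [u]. *)
Lemma integral_survival (G : R -> \bar R) : measurable_fun setT G ->
  (forall u, 0 <= G u) ->
  \int[mu]_(s in `]0%R, +oo[)
    ((r s * expR (- J s))%:E * \int[mu]_(u in `]0%R, s]) G u) =
  \int[mu]_(u in `]0%R, +oo[) ((expR (- J u))%:E * G u).
Proof.
move=> mG G0.
have mg := jump_density_measurable mr c0 cr rC.
pose f (z : measurableTypeR R * measurableTypeR R) : \bar R :=
  if (0 < z.2)%R && (z.2 <= z.1)%R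
  then (r z.1 * expR (- J z.1))%:E * G z.2 else 0.
have f0 z : 0 <= f z.
  rewrite /f; case: ifP => // _; rewrite mule_ge0// lee_fin.
  exact: (jump_density_ge0 c0 cr).
have mf : measurable_fun setT f.
  apply: measurable_fun_ifT.
  - apply: measurable_and; first exact: measurable_fun_ltr.
    exact: measurable_fun_ler.
  - apply: emeasurable_funM; last exact: measurableT_comp.
    by apply/measurable_EFinP; exact: (measurableT_comp mg).
  - exact: measurable_cst.
transitivity (\int[mu]_s \int[mu]_u f (s, u)).
  rewrite [LHS]integral_mkcond; apply: eq_integral => s _.
  rewrite patchE mem_setE in_itv/= andbT; case: ifPn => s0.
    rewrite -ge0_integralZl//; last 2 first.
    - exact: measurable_funTS.
    - by rewrite lee_fin (jump_density_ge0 c0 cr).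
    rewrite [LHS]integral_mkcond; apply: eq_integral => u _.
    by rewrite patchE /f/= mem_setE in_itv/=.
  rewrite -leNgt in s0.
  rewrite [RHS]integral0_eq// => u _; rewrite /f/=; case: ifPn => // /andP[u0 us].
  by move: (lt_le_trans u0 (le_trans us s0)); rewrite ltxx.
transitivity (\int[mu]_u \int[mu]_s f (s, u)).
  exact: (fubini_tonelli f mf f0).
rewrite [RHS]integral_mkcond; apply: eq_integral => u _.
rewrite patchE mem_setE in_itv/= andbT; case: ifPn => u0.
  rewrite -(survival_tail (ltW u0)) integral_itv_obnd_cbnd; last first.
    exact/measurable_EFinP/measurable_funTS.
  rewrite -ge0_integralZr//; last 2 first.
  - exact/measurable_EFinP/measurable_funTS.
  - by move=> s _; rewrite lee_fin (jump_density_ge0 c0 cr).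
  rewrite [RHS]integral_mkcond; apply: eq_integral => s _.
  by rewrite patchE /f/= mem_setE in_itv/= andbT u0.
by rewrite integral0_eq// => s _; rewrite /f/= (negbTE u0).
Qed.

End survival_tail.

(** * Complements on integration and product measures *)

Section integral_extra.
Local Open Scope ereal_scope.
Context d (T : measurableType d) (R : realType).
Variable mu : {measure set T -> \bar R}.
Import HBNNSimple.

(** The integral of a nonnegative function is a supremum over the simple functions
    below it, so that it is monotone even on functions that are not measurable. It is
    applied to path costs. *)
Lemma ge0_le_integral_total (f g : T -> \bar R) : (forall x, 0 <= f x) ->
  (forall x, f x <= g x) -> \int[mu]_x f x <= \int[mu]_x g x.
Proof.
move=> f0 fg; rewrite !ge0_integralTE//; last first.
  by move=> x; exact: le_trans (fg x).
apply: le_ereal_sup => _ [h hf <-]; exists h => //= x.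
exact: le_trans (fg x).
Qed.

Lemma ge0_le_integral_in (D : set T) (f g : T -> \bar R) :
  (forall x, D x -> 0 <= f x) -> (forall x, D x -> f x <= g x) ->
  \int[mu]_(x in D) f x <= \int[mu]_(x in D) g x.
Proof.
move=> f0 fg; rewrite [leLHS]integral_mkcond [leRHS]integral_mkcond.
apply: ge0_le_integral_total => x; rewrite !patchE.
  by case: ifPn => // /set_mem /f0.
by case: ifPn => // /set_mem /fg.
Qed.

(** The function [f] is replaced by 0 on a measurable null set. *)
Lemma ae_ge0_le_integral_measl (f g : T -> \bar R) :
  measurable_fun setT f -> (forall x, 0 <= f x) -> (forall x, 0 <= g x) ->
  {ae mu, forall x, f x <= g x} -> \int[mu]_x f x <= \int[mu]_x g x.
Proof.
move=> mf f0 g0 [N [mN N0 fgN]].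
have -> : \int[mu]_x f x = \int[mu]_x (f \_ (~` N)) x.
  apply: ge0_ae_eq_integral => //.
  - by apply/(measurable_restrictT _ _).1; [exact: measurableC|exact: measurable_funTS].
  - by move=> x _; apply: erestrict_ge0.
  - exists N; split=> // x /= /not_implyP[_] h; apply: contrapT => Nx.
    by apply: h; rewrite patchE mem_set.
apply: ge0_le_integral_total => x; first exact: erestrict_ge0.
rewrite patchE; case: ifPn => // /set_mem Nx.
by apply: contrapT => h; apply: Nx; apply: fgN => /h.
Qed.

(** The function [g] is replaced by [+oo] on a measurable null set. *)
Lemma ae_ge0_le_integral_measr (f g : T -> \bar R) :
  measurable_fun setT g -> (forall x, 0 <= f x) -> (forall x, 0 <= g x) ->
  {ae mu, forall x, f x <= g x} -> \int[mu]_x f x <= \int[mu]_x g x.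
Proof.
move=> mg f0 g0 [N [mN N0 fgN]].
pose g' x := if x \in N then +oo else g x.
have mg' : measurable_fun setT g'.
  apply: measurable_fun_ifT => //; apply: (measurable_fun_bool true).
  rewrite setTI (_ : _ @^-1` _ = N)//; apply/seteqP; split => x /=.
    by move/set_mem.
  by move/mem_set.
have g'0 x : 0 <= g' x by rewrite /g'; case: ifP.
have -> : \int[mu]_x g x = \int[mu]_x g' x.
  apply: ge0_ae_eq_integral => //.
  exists N; split=> // x /= /not_implyP[_] h; apply: contrapT => Nx.
  by apply: h; rewrite /g' memNset.
apply: ge0_le_integral_total => // x; rewrite /g'.
case: ifPn => [_|/negP Nx]; first exact: leey.
by apply: contrapT => h; apply: Nx; apply/mem_set/fgN => /h.
Qed.

End integral_extra.

Section lebesgue_shift.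
Local Open Scope ereal_scope.
Context (R : realType).
Notation mu := (@lebesgue_measure R).

Lemma lebesgue_measure_shift (a : R) (A : set R) : measurable A ->
  pushforward mu (+%R a : measurableTypeR R -> measurableTypeR R) A = mu A.
Proof.
have ma : measurable_fun setT (+%R a : measurableTypeR R -> measurableTypeR R).
  by apply: (@measurable_funD _ (measurableTypeR R)) => //; exact: measurable_cst.
pose mf := isMeasurableFun.Build _ _ (measurableTypeR R) (measurableTypeR R) _ ma.
pose f : {mfun measurableTypeR R >-> measurableTypeR R} :=
  HB.pack (+%R a : measurableTypeR R -> measurableTypeR R) mf.
move=> mA; apply/esym.
apply: (@lebesgue_measure_unique _ (pushforward lebesgue_measure f)) => //= _ [[s t]] _ <-.
transitivity (lebesgue_measure (`](s - a)%R, (t - a)%R]%classic : set R)).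
  rewrite !lebesgue_measure_itv/= !lte_fin ltrD2r; case: ifPn => // _.
  by rewrite -!EFinB opprB addrA subrK.
congr (lebesgue_measure _); apply/seteqP.
by split => x /=; rewrite !in_itv/= ltrBlDl lerBrDl.
Qed.

Lemma ge0_integral_shift (a : R) (D : set R) (f : R -> \bar R) :
  measurable D -> measurable_fun setT f -> (forall x, 0 <= f x) ->
  \int[mu]_(x in D) f x = \int[mu]_(x in [set x | D (a + x)%R]) f (a + x)%R.
Proof.
move=> mD mf f0.
have ma : measurable_fun setT (+%R a : measurableTypeR R -> measurableTypeR R).
  by apply: (@measurable_funD _ (measurableTypeR R)) => //; exact: measurable_cst.
transitivity (\int[pushforward mu (+%R a : measurableTypeR R -> measurableTypeR R)]_(x in D) f x).
  by apply: eq_measure_integral => A mA _; exact/esym/lebesgue_measure_shift.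
rewrite (ge0_integral_pushforward ma)//; exact: measurable_funTS.
Qed.

End lebesgue_shift.

Section density.
Local Open Scope ereal_scope.
Context d (T : measurableType d) (R : realType).
Variables (m : {measure set T -> \bar R}) (k : T -> R).
Hypotheses (mk : measurable_fun setT k) (k0 : forall x, (0 <= k x)%R).

Let mkE : measurable_fun setT (EFin \o k). Proof. exact/measurable_EFinP. Qed.

(** The two proofs are arguments in order that unification can find the measure
    structure. *)
Definition density_measure of measurable_fun setT k & (forall x, (0 <= k x)%R) :=
  fun A : set T => \int[m]_(x in A) (k x)%:E.

Local Notation dm := (density_measure mk k0).

Let dm0 : dm set0 = 0. Proof. exact: integral_set0. Qed.
Let dm_ge0 A : 0 <= dm A.
Proof. by apply: integral_ge0 => x _; rewrite lee_fin. Qed.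
Let dm_add : semi_sigma_additive dm.
Proof. by apply: semi_sigma_additive_nng_induced => // x; rewrite lee_fin. Qed.

HB.instance Definition _ := isMeasure.Build _ _ _ dm dm0 dm_ge0 dm_add.

Import HBNNSimple.

Lemma integral_density_measure (f : T -> \bar R) : measurable_fun setT f ->
  (forall x, 0 <= f x) ->
  \int[dm]_x f x = \int[m]_x (f x * (k x)%:E).
Proof.
move=> mf f0.
pose f_ := nnsfun_approx measurableT mf.
transitivity (limn (fun n => \int[dm]_x (f_ n x)%:E)).
  rewrite -monotone_convergence//.
  - by apply: eq_integral => y _; apply/esym/cvg_lim => //; exact: cvg_nnsfun_approx.
  - by move=> n; exact/measurable_EFinP/measurable_funP.
  - by move=> n y _; rewrite lee_fin.
  - by move=> y _ a b ab; rewrite lee_fin; exact/lefP/nd_nnsfun_approx.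
transitivity (limn (fun n => \int[m]_x ((f_ n x)%:E * (k x)%:E))); last first.
  rewrite -monotone_convergence//.
  - apply: eq_integral => y _; apply/cvg_lim => //.
    by apply: cvgeZr => //; exact: cvg_nnsfun_approx.
  - move=> n; apply: emeasurable_funM => //; exact/measurable_EFinP/measurable_funP.
  - by move=> n y _; rewrite mule_ge0// lee_fin.
  - move=> y _ a b ab; apply: lee_wpmul2r; first by rewrite lee_fin.
    by rewrite lee_fin; exact/lefP/nd_nnsfun_approx.
congr (limn _); apply/funext => n; move: (f_ n) => g.
transitivity (\sum_(y \in range g) (y%:E * dm (g @^-1` [set y]))).
  under eq_integral do rewrite fimfunE -fsumEFin//.
  rewrite ge0_integral_fsum//; last 2 first.
  - by move=> y; exact/measurable_EFinP/measurable_funM.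
  - by move=> y x _; rewrite nnfun_muleindic_ge0.
  apply: eq_fsbigr => y _.
  by rewrite integralZl_indic_nnsfun// integral_indic// setIT.
under [RHS]eq_integral.
  move=> x _; rewrite fimfunE -fsumEFin// ge0_mule_fsuml//; last first.
    by move=> y; rewrite nnfun_muleindic_ge0.
  over.
rewrite ge0_integral_fsum//; last 2 first.
- by move=> y; apply: emeasurable_funM => //; exact/measurable_EFinP/measurable_funM.
- by move=> y x _; rewrite mule_ge0 ?nnfun_muleindic_ge0// lee_fin.
apply: eq_fsbigr => y /[!inE] -[x _ gxy].
have y0 : (0 <= y)%R by rewrite -gxy.
have mD : measurable (g @^-1` [set y]) by exact: measurable_sfunP.
rewrite /density_measure -ge0_integralZl//; last 2 first.
- exact: measurable_funTS mkE.
- by move=> z _; rewrite lee_fin.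
rewrite integral_mkcond; apply: eq_integral => z _.
rewrite patchE indicE; case: ifPn => _; first by rewrite mulr1.
by rewrite mulr0 mul0e.
Qed.

End density.

Section measurability.
Local Open Scope ereal_scope.
Context d (X : measurableType d) (R : realType).
Notation mu := (@lebesgue_measure R).

(** Gluing along the countably many values of a discrete parameter. *)
Lemma measurable_fun_nat_family d' (Y : measurableType d') (g : X -> nat)
    (F : nat -> X -> Y) : measurable_fun setT g ->
  (forall n, measurable_fun setT (F n)) -> measurable_fun setT (fun x => F (g x) x).
Proof.
move=> mg mF _ A mA; rewrite setTI.
have -> : (fun x => F (g x) x) @^-1` A =
    \bigcup_n (g @^-1` [set n] `&` F n @^-1` A).
  apply/seteqP; split => [x/= Ax|x [n _ [/= <-]]//].
  by exists (g x).
apply: bigcup_measurable => n _; apply: measurableI.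
  by rewrite -[X in measurable X]setTI; exact: mg.
by rewrite -[X in measurable X]setTI; exact: mF.
Qed.

Lemma measurable_integral_itv (s : X -> R) (f : X * R -> \bar R) :
  measurable_fun setT s -> measurable_fun setT f -> (forall x, 0 <= f x) ->
  measurable_fun setT (fun x => \int[mu]_(u in `]0%R, s x]) f (x, u)).
Proof.
move=> ms mf f0.
pose g (z : X * measurableTypeR R) : \bar R :=
  if ((0 < z.2) && (z.2 <= s z.1))%R then f z else 0.
have g0 z : 0 <= g z by rewrite /g; case: ifP.
have mg : measurable_fun setT g.
  apply: measurable_fun_ifT => //.
  apply: measurable_and.
    by apply: measurable_fun_ltr => //; exact: measurable_cst.
  by apply: measurable_fun_ler => //; exact: measurableT_comp.
have := @measurable_fun_fubini_tonelli_F _ _ _ _ _ lebesgue_measure g mg g0.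
apply: eq_measurable_fun => x _.
rewrite [RHS]integral_mkcond; apply: eq_integral => u _.
by rewrite patchE mem_setE in_itv.
Qed.

End measurability.

Section rectangles.
Local Open Scope ereal_scope.
Context d1 d2 (X : measurableType d1) (Y : measurableType d2) (R : realType).

Lemma measure_unique_rectangles (m1 m2 : {measure set (X * Y) -> \bar R}) :
  m1 setT < +oo ->
  (forall A B, measurable A -> measurable B -> m1 (A `*` B) = m2 (A `*` B)) ->
  forall C, measurable C -> m1 C = m2 C.
Proof.
move=> m1oo m12 C mC.
pose G : set (set (X * Y)) :=
  [set C | exists A, measurable A /\ exists B, measurable B /\ C = A `*` B].
have GI : setI_closed G.
  move=> /= _ _ [X1 [mX1 [X2 [mX2 ->]]]] [Y1 [mY1 [Y2 [mY2 ->]]]].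
  rewrite -setXI; exists (X1 `&` Y1); split; first exact: measurableI.
  by exists (X2 `&` Y2); split => //; exact: measurableI.
apply: (measure_unique G (fun=> setT)) => //.
- rewrite measurable_prod_measurableType //; congr (<<s _ >>).
  rewrite predeqE; split => [[A mA [B mB <-]]|[A [mA [B [mB ->]]]]].
    by exists A; split => //; exists B.
  by exists A => //; exists B.
- move=> n; exists setT; split => //; exists setT; split => //.
  by rewrite setXTT.
- by rewrite bigcup_const//; exists 0%N.
- by move=> _ [A [mA [B [mB ->]]]]; exact: m12.
Qed.
End rectangles.

Section disintegration.
Local Open Scope ereal_scope.
Context d d1 d2 (W : measurableType d) (X : measurableType d1)
  (Y : measurableType d2) (R : realType).
Variables (P : {measure set W -> \bar R}) (D : set W) (phi : W -> X * Y).
Variables (m : {measure set (X * Y) -> \bar R}) (k : X * Y -> R).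
Hypotheses (Pfin : P setT < +oo) (mD : measurable D) (mphi : measurable_fun setT phi).
Hypotheses (mk : measurable_fun setT k) (k0 : forall x, (0 <= k x)%R).
Hypothesis rectE : forall A B, measurable A -> measurable B ->
  P (D `&` phi @^-1` (A `*` B)) = \int[m]_(x in A `*` B) (k x)%:E.

Let mI : measurable_fun setT (\1_D : W -> R).
Proof. exact: measurable_indic. Qed.

Let I0 w : (0 <= (\1_D w : R))%R.
Proof. by []. Qed.

Let nu0 : {measure set W -> \bar R} := density_measure P mI I0.
(* The structure is named because the measurability of phi is one of its arguments. *)
Let nu : {measure set (X * Y) -> \bar R} :=
  measure_function_pushforward__canonical__measure_function_Measure nu0 mphi.
Let kM : {measure set (X * Y) -> \bar R} := density_measure m mk k0.

Let nuE C : measurable C -> nu C = P (D `&` phi @^-1` C).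
Proof.
move=> mC; rewrite /nu/= /pushforward /nu0/= /density_measure.
rewrite integral_indic// -[X in measurable X]setTI; exact: mphi.
Qed.

(** If on rectangles the image under [phi] of [P] restricted to [D] has density [k] with
    respect to [m], then so it has on all measurable sets, by uniqueness of finite
    measures on a pi-system. *)
Lemma integral_disintegration (F : X * Y -> \bar R) : measurable_fun setT F ->
  (forall x, 0 <= F x) ->
  \int[P]_(w in D) F (phi w) = \int[m]_x (F x * (k x)%:E).
Proof.
move=> mF F0.
have nuk C : measurable C -> nu C = kM C.
  apply: measure_unique_rectangles.
    rewrite nuE// (le_lt_trans _ Pfin)//; apply: le_measure; rewrite ?inE//.
    by rewrite preimage_setT setIT.
  by move=> A B mA mB; rewrite nuE ?rectE//; exact: measurableX.
rewrite -(integral_density_measure m mk k0)//.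
transitivity (\int[nu]_x F x); last first.
  by apply: eq_measure_integral => C mC _; exact: nuk.
rewrite (ge0_integral_pushforward mphi)// preimage_setT.
rewrite integral_density_measure; [|exact: measurableT_comp|by move=> w /=].
rewrite integral_mkcond; apply: eq_integral => w _.
rewrite patchE indicE; case: ifPn => _ /=; first by rewrite mule1.
by rewrite mule0.
Qed.

End disintegration.

(** * Jump rates and the density of a sojourn *)

Section rates.
Context (R : realType) (q : queue R).
Local Notation lambda := (arr_rate q).
Local Notation mu := (srv_rate q).

Lemma rate_ge0 i b j : 0 <= rate q i b j.
Proof.
rewrite /rate; case: ifP => _; first exact/ltW/arr_rate_gt0.
by case: ifP => // _; rewrite mulr_ge0// ltW// srv_rate_gt0.
Qed.

(** Only an arrival and, with the system on, a departure have a positive rate. For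
    [i = 0] the predecessor is 0, but the second coefficient vanishes. *)
Lemma sum_rate i b (phi : nat -> \bar R) :
  (\sum_(j < i.+2) ((rate q i b j)%:E * phi j) =
   lambda%:E * phi i.+1 + (b%:R * i%:R * mu)%:E * phi i.-1)%E.
Proof.
rewrite big_ord_recr/= {2}/rate eqxx addeC; congr (_ + _)%E.
rewrite big_ord_recr/= {2}/rate (ltn_eqF (ltnSn i)).
case: i => [|i]/=; first by rewrite big_ord0 add0e mulr0 mul0r !mul0e.
rewrite eqn_leq ltnn/= andbF mul0e adde0 big_ord_recr/= big1 ?add0e.
  rewrite /rate/= eqxx andbT (ltn_eqF (_ : i < i.+2)%N)//.
  by case: b; rewrite ?mul1r ?mul0r.
move=> j _; rewrite /rate (ltn_eqF (_ : j < i.+2)%N)/=; last first.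
  by rewrite (ltn_trans (ltn_ord j)).
by rewrite (ltn_eqF (ltn_ord j)) andbF mul0e.
Qed.

Lemma exit_rateE i b : exit_rate q i b = lambda + b%:R * i%:R * mu.
Proof.
apply: EFin_inj; rewrite /exit_rate -sumEFin EFinD.
have := sum_rate i b (cst 1%E); rewrite /= !mule1 => <-.
by apply: eq_bigr => j _; rewrite mule1.
Qed.

Lemma rate_eq0 i b j : (i.+1 < j)%N -> rate q i b j = 0.
Proof.
move=> ij; rewrite /rate gtn_eqF// ifF// gtn_eqF ?andbF//.
by rewrite (leq_ltn_trans (leq_pred _))// (leq_ltn_trans _ ij).
Qed.

End rates.

Lemma measurable_if_fun d (X : measurableType d) d' (Y : measurableType d')
    (b : X -> bool) (F : bool -> X -> Y) : measurable_fun setT b ->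
  (forall a, measurable_fun setT (F a)) -> measurable_fun setT (fun x => F (b x) x).
Proof.
move=> mb mF.
rewrite (_ : (fun x => _) = (fun x => if b x then F true x else F false x)).
  exact: measurable_fun_ifT.
by apply/funext => x; case: (b x).
Qed.

Lemma measurable_last_state (R : realType) n :
  measurable_fun setT (fun h : hist R n => last_state h).
Proof. exact: measurableT_comp measurable_snd (measurable_tnth _). Qed.

Lemma measurable_last_count (R : realType) n :
  measurable_fun setT (fun h : hist R n => (last_state h).1).
Proof. exact: measurableT_comp measurable_fst (@measurable_last_state _ _). Qed.

Lemma measurable_last_status (R : realType) n :
  measurable_fun setT (fun h : hist R n => (last_state h).2).
Proof. exact: measurableT_comp measurable_snd (@measurable_last_state _ _). Qed.

Lemma measurable_last_time (R : realType) n :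
  measurable_fun setT (fun h : hist R n => (tnth h ord_max).1).
Proof. exact: measurableT_comp measurable_fst (measurable_tnth _). Qed.

Section sojourn_density.
Context (R : realType) (q : queue R) (p : policy R) (pol : is_policy p) (n : nat).
Local Notation leb := (@lebesgue_measure R).

Definition sojourn_rate (h : hist R n) (u : R) : R :=
  exit_rate q (last_state h).1 (p h u).

(** The density of [jump_kernel] in the sojourn time, as a function of the history and
    the sojourn time; see [jump_kernelE]. *)
Definition sojourn_density (z : state) (x : hist R n * R) : R :=
  if 0 < x.2 then
    (p x.1 x.2 == z.2)%:R * rate q (last_state x.1).1 (p x.1 x.2) z.1 *
    expR (- hazard (sojourn_rate x.1) x.2)
  else 0.

Lemma measurable_policy : measurable_fun setT (fun x : hist R n * R => p x.1 x.2).
Proof. by case: pol. Qed.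

(** The rates depend on the history and the time only through two discrete
    quantities, the number of customers and the action. *)
Lemma measurable_policy_state d (Y : measurableType d)
    (F : nat -> bool -> hist R n * R -> Y) :
  (forall i b, measurable_fun setT (F i b)) ->
  measurable_fun setT (fun x => F (last_state x.1).1 (p x.1 x.2) x).
Proof.
move=> mF.
apply: (@measurable_fun_nat_family _ _ _ _ (fun x : hist R n * R => (last_state x.1).1)
   (fun i x => F i (p x.1 x.2) x)).
  exact: measurableT_comp (@measurable_last_count R n) measurable_fst.
move=> i; apply: (@measurable_if_fun _ _ _ _ (fun x : hist R n * R => p x.1 x.2) (F i)) => //.
exact: measurable_policy.
Qed.

Lemma measurable_sojourn_rate :
  measurable_fun setT (fun x : hist R n * R => sojourn_rate x.1 x.2).
Proof.
apply: (measurable_policy_state (F := fun i b _ => exit_rate q i b)) => i b.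
exact: measurable_cst.
Qed.

Lemma sojourn_rate_ge h u : arr_rate q <= sojourn_rate h u.
Proof.
by rewrite /sojourn_rate exit_rateE lerDl !mulr_ge0// ltW// srv_rate_gt0.
Qed.

Lemma sojourn_rate_le h u : sojourn_rate h u <=
  arr_rate q + (last_state h).1%:R * srv_rate q.
Proof.
rewrite /sojourn_rate exit_rateE lerD2l; case: (p h u); rewrite ?mul1r// !mul0r.
by rewrite mulr_ge0// ltW// srv_rate_gt0.
Qed.

Lemma measurable_sojourn_rate1 h : measurable_fun setT (sojourn_rate h).
Proof.
exact: measurableT_comp measurable_sojourn_rate (pair1_measurable h).
Qed.

Lemma measurable_sojourn_survival : measurable_fun setT
  (fun x : hist R n * R => expR (- hazard (sojourn_rate x.1) x.2)).
Proof.
apply: measurableT_comp => //; apply: measurableT_comp => //.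
apply: measurableT_comp => //.
apply: (@measurable_integral_itv _ _ _ snd
  (fun y : (hist R n * R) * R => (sojourn_rate y.1.1 y.2)%:E)) => //.
  apply/measurable_EFinP.
  apply: (@measurableT_comp _ _ _ _ _ _ (fun x : hist R n * R => sojourn_rate x.1 x.2) _
     (fun y : (hist R n * R) * R => (y.1.1, y.2)) measurable_sojourn_rate).
  apply: measurable_fun_pair => //.
  by apply: measurableT_comp => //.
by move=> x; rewrite lee_fin (le_trans _ (sojourn_rate_ge _ _))// ltW// arr_rate_gt0.
Qed.

Lemma measurable_sojourn_density z : measurable_fun setT (sojourn_density z).
Proof.
apply: measurable_fun_ifT => //.
  by apply: measurable_fun_ltr => //; exact: measurable_cst.
apply: measurable_funM; last exact: measurable_sojourn_survival.
apply: (measurable_policy_state (F := fun i b _ => (b == z.2)%:R * rate q i b z.1)) => i b.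
exact: measurable_cst.
Qed.

Lemma sojourn_density_ge0 z x : 0 <= sojourn_density z x.
Proof.
rewrite /sojourn_density; case: ifP => // _.
by rewrite !mulr_ge0 ?rate_ge0 ?expR_ge0.
Qed.

Lemma jump_kernelE h B j a : measurable B ->
  jump_kernel q (last_state h).1 (p h) B j a =
  (\int[leb]_(s in B) (sojourn_density (j, a) (h, s))%:E)%E.
Proof.
move=> mB; rewrite /jump_kernel integral_mkcondr; apply: eq_integral => s _.
rewrite patchE mem_setE in_itv/= andbT /sojourn_density/=.
by case: ifP.
Qed.

End sojourn_density.

(** * The expectation over one sojourn *)

Lemma measurable_state_family d (X : measurableType d) d' (Y : measurableType d')
    (g : X -> state) (F : state -> X -> Y) : measurable_fun setT g ->
  (forall z, measurable_fun setT (F z)) -> measurable_fun setT (fun x => F (g x) x).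
Proof.
move=> mg mF.
rewrite (_ : (fun x => _) = (fun x => F ((g x).1, (g x).2) x)); last first.
  by apply/funext => x; rewrite -surjective_pairing.
apply: (measurable_fun_nat_family (F := fun i x => F (i, (g x).2) x)).
  exact: measurableT_comp measurable_fst mg.
move=> i; apply: (@measurable_if_fun _ _ _ _ (fun x => (g x).2) (fun a => F (i, a))) => //.
exact: measurableT_comp measurable_snd mg.
Qed.

(** An enumeration of the states, which turns the sum over the next states into a
    series. *)
Definition nth_state (k : nat) : state := (k./2, odd k).

Lemma nth_state_surj (z : state) : nth_state (z.2 + z.1.*2) = z.
Proof.
by case: z => i a; rewrite /nth_state/= halfD odd_double doubleK andbF oddD odd_double addbF;
  case: a.
Qed.

Lemma nth_state_inj : injective nth_state.
Proof.
by move=> k l [kl okl]; rewrite -(odd_double_half k) -(odd_double_half l) kl okl.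
Qed.

Lemma sum_nth_state (R : realType) (N : nat) (f : state -> \bar R) :
  (\sum_(0 <= k < N.*2) f (nth_state k) = \sum_(j < N) (f (j : nat, false) + f (j : nat, true)))%E.
Proof.
elim: N => [|N IH]; first by rewrite big_nil big_ord0.
rewrite doubleS !big_nat_recr//= IH big_ord_recr/= addeA /nth_state/=.
by rewrite uphalf_double doubleK odd_double.
Qed.

Lemma nneseries_finite_support (R : realType) (f : nat -> \bar R) (N : nat) :
  (forall k, 0 <= f k)%E -> (forall k, (N <= k)%N -> f k = 0%E) ->
  (\sum_(k <oo) f k = \sum_(0 <= k < N) f k)%E.
Proof.
move=> f0 fN; rewrite (nneseries_split 0 N (fun k _ => f0 k)).
by rewrite [X in (_ + X)%E]eseries0 ?adde0// => k + _ => /fN.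
Qed.

Section step.
Context (R : realType) (q : queue R) (d : measure_display) (Omega : measurableType d).
Variables (T : nat -> Omega -> R) (Z : nat -> Omega -> state).
Hypotheses (mT : forall n, measurable_fun setT (T n)).
Hypotheses (mZ : forall n, measurable_fun setT (Z n)).
Variables (p : policy R) (z0 : state) (P : probability Omega R).
Hypotheses (pol : is_policy p) (law : policy_law T Z q p z0 P).
Local Notation leb := (@lebesgue_measure R).
Local Notation hst := (history T Z).
Local Notation tau n w := (T n.+1 w - T n w).

Lemma tnth_history n w (i : 'I_n.+1) : tnth (hst n w) i = (T i w, Z i w).
Proof. by rewrite tnth_mktuple. Qed.

Lemma last_history n w : last_state (hst n w) = Z n w.
Proof. by rewrite /last_state tnth_history. Qed.

Lemma last_time_history n w : (tnth (hst n w) ord_max).1 = T n w.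
Proof. by rewrite tnth_history. Qed.

Lemma measurable_history n : measurable_fun setT (hst n).
Proof.
apply/measurable_fun_tnthP => i.
rewrite (_ : _ \o _ = fun w => (T i w, Z i w)).
  exact: measurable_fun_pair.
by apply/funext => w /=; rewrite tnth_history.
Qed.

Lemma measurable_tau n : measurable_fun setT (fun w => tau n w).
Proof. exact: measurable_funB. Qed.

Lemma measurable_history_tau n :
  measurable_fun setT (fun w => (hst n w, tau n w)).
Proof.
by apply: measurable_fun_pair; [exact: measurable_history|exact: measurable_tau].
Qed.

Lemma measurable_stateP (z : state) n : measurable [set w | Z n w = z].
Proof.
have -> : [set w | Z n w = z] = setT `&` Z n @^-1` [set z] by rewrite setTI.
apply: mZ => //.
have -> : [set z] = ([set z.1] `*` [set z.2])%classic.
  by apply/seteqP; case: z => i a; split=> [_ -> //|[j b] /= [-> ->]].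
exact: measurableX.
Qed.

Local Open Scope ereal_scope.

Section fixed_step.
Variable n : nat.

Let history_mixin := isMeasurableFun.Build _ _ _ _ (hst n) (@measurable_history n).
Let history_mfun : {mfun Omega >-> hist R n} := HB.pack (hst n) history_mixin.

Let M : {measure set (hist R n * measurableTypeR R) -> \bar R} :=
  (distribution P history_mfun \x lebesgue_measure).

Let integral_M (F : hist R n * R -> \bar R) : measurable_fun setT F ->
  (forall x, 0 <= F x) ->
  \int[M]_x F x = \int[P]_w \int[leb]_s F (hst n w, s).
Proof.
move=> mF F0; rewrite /M fubini_tonelli1// ge0_integral_distribution//.
- exact: measurable_fun_fubini_tonelli_F.
- by move=> h; apply: integral_ge0.
Qed.

(** The law of the process prescribes the probabilities of rectangles only. *)
Lemma next_state_disintegration (z : state) (F : hist R n * R -> \bar R) :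
  measurable_fun setT F -> (forall x, 0 <= F x) ->
  \int[P]_(w in [set w | Z n.+1 w = z]) F (hst n w, tau n w) =
  \int[M]_x (F x * (sojourn_density q p z x)%:E).
Proof.
move=> mF F0.
have mk := measurable_sojourn_density q pol (n := n) z.
have k0 := @sojourn_density_ge0 R q p n z.
have Pfin : P setT < +oo by rewrite probability_setT ltry.
apply: (@integral_disintegration _ _ _ Omega (hist R n) (measurableTypeR R) R P _
  (fun w => (hst n w, tau n w)) M _ Pfin (measurable_stateP z n.+1)
  (@measurable_history_tau n) mk k0 _ F mF F0) => A B mA mB.
transitivity (P [set w | [/\ A (hst n w), B (tau n w) & Z n.+1 w = (z.1, z.2)]]).
  congr (P _); apply/seteqP; split => w /=.
    by move=> [-> [Ah Bt]]; split => //; case: (z).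
  by move=> [Ah Bt ->]; split => //; case: (z).
rewrite (law.2 n)//.
rewrite integral_mkcond [RHS]integral_mkcond integral_M; last 2 first.
- apply/(measurable_restrictT _ _).1; first exact: measurableX.
  by apply/measurable_funTS/measurable_EFinP.
- by move=> x; apply: erestrict_ge0 => ? _; rewrite lee_fin.
apply: eq_integral => w _; rewrite patchE.
case: ifPn => [/set_mem Ah|/negP Ah].
  rewrite -(last_history n w) jump_kernelE//.
  rewrite integral_mkcond; apply: eq_integral => s _.
  rewrite !patchE; congr (if _ then _ else _).
  by apply/idP/idP => /set_mem; [move=> Bs; apply/mem_set|move=> [_ Bs]; exact/mem_set].
rewrite integral0_eq// => s _; rewrite patchE ifF//.
by apply/negP => /set_mem[/= /mem_set].
Qed.

Lemma sum_sojourn_density (F : state -> hist R n * R -> \bar R) (h : hist R n) (s : R) :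
  (forall z x, 0 <= F z x) -> (0 < s)%R ->
  \sum_(k <oo) (F (nth_state k) (h, s) * (sojourn_density q p (nth_state k) (h, s))%:E) =
  (expR (- hazard (sojourn_rate q p h) s))%:E *
   ((arr_rate q)%:E * F ((last_state h).1.+1, p h s) (h, s) +
    ((p h s)%:R * (last_state h).1%:R * srv_rate q)%:E *
      F ((last_state h).1.-1, p h s) (h, s)).
Proof.
move=> F0 s0; set i := (last_state h).1; set b := p h s.
have d0 z : 0 <= F z (h, s) * (sojourn_density q p z (h, s))%:E.
  by rewrite mule_ge0// lee_fin sojourn_density_ge0.
rewrite (@nneseries_finite_support _ _ i.+2.*2)//; last first.
  move=> k ik; rewrite /sojourn_density/= s0 rate_eq0 ?mulr0 ?mul0r ?mule0//.
  by rewrite -/i -(doubleK i.+2) half_leq.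
rewrite (sum_nth_state _ (fun z => F z (h, s) * (sojourn_density q p z (h, s))%:E)).
rewrite -(sum_rate q i b (fun j => F (j, b) (h, s))) ge0_sume_distrr; last first.
  by move=> j _; rewrite mule_ge0// lee_fin rate_ge0.
apply: eq_bigr => j _; rewrite /sojourn_density/= s0 -/i -/b.
by case: b; rewrite /= !(mul0r, mule0, add0e, adde0) mul1r EFinM;
  rewrite muleC -muleA muleCA.
Qed.

(** The probability is split according to the next state; of the resulting series of
    integrals only the two terms of [sum_rate] survive. *)
Theorem expectation_next (F : state -> hist R n * R -> \bar R) :
  (forall z, measurable_fun setT (F z)) -> (forall z x, 0 <= F z x) ->
  \int[P]_w F (Z n.+1 w) (hst n w, tau n w) =
  \int[P]_w \int[leb]_(s in `]0%R, +oo[)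
    ((expR (- hazard (sojourn_rate q p (hst n w)) s))%:E *
     ((arr_rate q)%:E * F ((Z n w).1.+1, p (hst n w) s) (hst n w, s) +
      ((p (hst n w) s)%:R * (Z n w).1%:R * srv_rate q)%:E *
        F ((Z n w).1.-1, p (hst n w) s) (hst n w, s))).
Proof.
move=> mF F0.
pose D k := [set w | Z n.+1 w = nth_state k].
have DT : setT = \bigcup_k D k.
  apply/seteqP; split => // w _.
  by exists ((Z n.+1 w).2 + (Z n.+1 w).1.*2)%N => //; rewrite /D/= nth_state_surj.
have mD k : measurable (D k) by exact: measurable_stateP.
have d0 k x : 0 <= F (nth_state k) x * (sojourn_density q p (nth_state k) x)%:E.
  by rewrite mule_ge0// lee_fin sojourn_density_ge0.
have md k : measurable_fun setT
    (fun x => F (nth_state k) x * (sojourn_density q p (nth_state k) x)%:E).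
  apply: emeasurable_funM => //; apply/measurable_EFinP.
  exact: (measurable_sojourn_density q pol).
rewrite [in LHS]DT ge0_integral_bigcup//; first last.
- move=> k l _ _ [w []]; rewrite /D/= => -> ; exact: nth_state_inj.
- apply: measurable_funTS.
  apply: (@measurable_state_family _ _ _ _ (Z n.+1)
    (fun z w => F z (hst n w, tau n w))) => // z.
  exact: measurableT_comp (mF z) (@measurable_history_tau n).
transitivity (\sum_(k <oo) \int[M]_x
    (F (nth_state k) x * (sojourn_density q p (nth_state k) x)%:E)).
  apply: eq_eseriesr => k _; rewrite -next_state_disintegration//.
  by apply: eq_integral => w /set_mem; rewrite /D/= => ->.
rewrite -integral_nneseries// integral_M; last 2 first.
- by apply: ge0_emeasurable_sum.
- by move=> x; apply: nneseries_ge0.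
apply: eq_integral => w _; rewrite [RHS]integral_mkcond; apply: eq_integral => s _.
rewrite patchE mem_setE in_itv/= andbT; case: ifPn => s0.
  by rewrite sum_sojourn_density// last_history.
rewrite eseries0// => k _ _.
by rewrite /sojourn_density/= (negbTE s0) mule0.
Qed.
End fixed_step.
End step.

(** The part of the payoff that does not depend on the next state collects the total
    jump rate. *)
Lemma ge0_mule_mixture (R : realDomainType) (a b x y z : \bar R) :
  (0 <= a -> 0 <= b -> 0 <= x -> 0 <= y -> 0 <= z ->
  a * (x + y) + b * (x + z) = (a + b) * x + (a * y + b * z))%E.
Proof.
by move=> a0 b0 x0 y0 z0; rewrite (ge0_muleDr a)// (ge0_muleDr b)// (ge0_muleDl x)// addeACA.
Qed.

Section discounted_step.
Context (R : realType) (q : queue R) (alpha : R) (d : measure_display) (Omega : measurableType d).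
Variables (T : nat -> Omega -> R) (Z : nat -> Omega -> state).
Hypotheses (mT : forall n, measurable_fun setT (T n)).
Hypotheses (mZ : forall n, measurable_fun setT (Z n)).
Variables (p : policy R) (z0 : state) (P : probability Omega R).
Hypotheses (pol : is_policy p) (law : policy_law T Z q p z0 P).
Hypothesis alpha_gt0 : 0 < alpha.
Local Notation leb := (@lebesgue_measure R).
Local Notation hst := (history T Z).
Local Notation tau n w := (T n.+1 w - T n w).
Local Open Scope ereal_scope.

(** By [integral_survival], the cost accumulated during the sojourn and the payment
    at its end become one integral against the survival function. *)
Lemma expectation_sojourn n (G : hist R n * R -> \bar R)
    (V : state -> hist R n * R -> \bar R) :
  measurable_fun setT G -> (forall x, 0 <= G x) ->
  (forall z, measurable_fun setT (V z)) -> (forall z x, 0 <= V z x) ->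
  \int[P]_w (\int[leb]_(u in `]0%R, tau n w]) G (hst n w, u) +
             V (Z n.+1 w) (hst n w, tau n w)) =
  \int[P]_w \int[leb]_(s in `]0%R, +oo[)
    ((expR (- hazard (sojourn_rate q p (hst n w)) s))%:E *
     (G (hst n w, s) +
      ((arr_rate q)%:E * V ((Z n w).1.+1, p (hst n w) s) (hst n w, s) +
      ((p (hst n w) s)%:R * (Z n w).1%:R * srv_rate q)%:E *
        V ((Z n w).1.-1, p (hst n w) s) (hst n w, s)))).
Proof.
move=> mG G0 mV V0.
pose IG (x : hist R n * R) := \int[leb]_(u in `]0%R, x.2]) G (x.1, u).
have IG0 x : 0 <= IG x by exact: integral_ge0.
have mIG : measurable_fun setT IG.
  apply: (@measurable_integral_itv _ _ _ snd (fun y : (hist R n * R) * R => G (y.1.1, y.2))) => //.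
  apply: (measurableT_comp mG); apply: measurable_fun_pair => //.
  exact: measurableT_comp.
have := @expectation_next _ q _ _ _ _ mT mZ p z0 P pol law n (fun z x => IG x + V z x).
rewrite {1}/IG/= => ->; last 2 first.
- by move=> z; exact: emeasurable_funD.
- by move=> z x; exact: adde_ge0.
apply: eq_integral => w _; set h := hst n w.
have mr := measurable_sojourn_rate1 q pol h.
have r0 := sojourn_rate_ge q p h.
have rC := sojourn_rate_le q p h.
have mS := survival_measurable mr (arr_rate_gt0 q) r0 rC.
have mp1 : measurable_fun setT (pair h : R -> hist R n * R) by exact: pair1_measurable.
pose VV s := (arr_rate q)%:E * V ((Z n w).1.+1, p h s) (h, s) +
      ((p h s)%:R * (Z n w).1%:R * srv_rate q)%:E * V ((Z n w).1.-1, p h s) (h, s).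
have VV0 s : 0 <= VV s.
  by rewrite adde_ge0// mule_ge0// lee_fin ?mulr_ge0// ltW// ?arr_rate_gt0// srv_rate_gt0.
have mph : measurable_fun setT (p h).
  exact: measurableT_comp (measurable_policy pol (n := n)) mp1.
have mVV : measurable_fun setT VV.
  apply: (@measurable_if_fun _ _ _ _ (p h) (fun b s =>
    (arr_rate q)%:E * V ((Z n w).1.+1, b) (h, s) +
      (b%:R * (Z n w).1%:R * srv_rate q)%:E * V ((Z n w).1.-1, b) (h, s))) => // b.
  by apply: emeasurable_funD; apply: measurable_funeM; exact: measurableT_comp (mV _) mp1.
have mG1 : measurable_fun setT (fun s => G (h, s)) by exact: measurableT_comp mp1.
have mIG1 : measurable_fun setT (fun s => IG (h, s)) by exact: measurableT_comp mp1.
transitivity (\int[leb]_(s in `]0%R, +oo[)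
   ((sojourn_rate q p h s * expR (- hazard (sojourn_rate q p h) s))%:E * IG (h, s) +
    (expR (- hazard (sojourn_rate q p h) s))%:E * VV s)).
  apply: eq_integral => s _.
  have e0 : 0 <= (expR (- hazard (sojourn_rate q p h) s))%:E by rewrite lee_fin expR_ge0.
  have rE : sojourn_rate q p h s = (arr_rate q + (p h s)%:R * (Z n w).1%:R * srv_rate q)%R.
    by rewrite /sojourn_rate exit_rateE last_history.
  have rs0 : 0 <= (sojourn_rate q p h s)%:E.
    by rewrite lee_fin (le_trans _ (r0 s))// ltW// arr_rate_gt0.
  rewrite (mulrC (sojourn_rate _ _ _ _)) (EFinM (expR _)).
  rewrite -(muleA (expR _)%:E) -ge0_muleDr//; last first.
    exact: mule_ge0.
  congr (_ * _); rewrite rE.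
  have a0 : 0 <= (arr_rate q)%:E by rewrite lee_fin ltW// arr_rate_gt0.
  have b0 : 0 <= ((p h s)%:R * (Z n w).1%:R * srv_rate q)%:E.
    by rewrite lee_fin !mulr_ge0// ltW// srv_rate_gt0.
  by rewrite EFinD; exact: ge0_mule_mixture.
rewrite ge0_integralD//=; last 4 first.
- by move=> s _; rewrite mule_ge0// lee_fin (jump_density_ge0 (arr_rate_gt0 q)).
- apply: measurable_funTS; apply: emeasurable_funM => //; apply/measurable_EFinP.
  exact: measurable_funM.
- by move=> s _; rewrite mule_ge0// lee_fin expR_ge0.
- by apply: measurable_funTS; apply: emeasurable_funM => //; apply/measurable_EFinP.
rewrite (integral_survival mr (arr_rate_gt0 q) r0 rC mG1)//.
rewrite -ge0_integralD//=; last 4 first.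
- by move=> s _; rewrite mule_ge0// lee_fin expR_ge0.
- by apply: measurable_funTS; apply: emeasurable_funM => //; apply/measurable_EFinP.
- by move=> s _; rewrite mule_ge0// lee_fin expR_ge0.
- by apply: measurable_funTS; apply: emeasurable_funM => //; apply/measurable_EFinP.
apply: eq_integral => s _; rewrite -ge0_muleDr//.
Qed.

Definition last_time n (h : hist R n) : R := (tnth h ord_max).1.

Section comparison.
Variable n : nat.
Variables (g : hist R n * R -> R) (v : state -> hist R n * R -> R).
Hypotheses (mg : measurable_fun setT g) (g0 : forall x, (0 <= g x)%R).
Hypotheses (mv : forall z, measurable_fun setT (v z)) (v0 : forall z x, (0 <= v z x)%R).

Let killed (h : hist R n) s := (alpha + sojourn_rate q p h s)%R.

(** The instantaneous payoff rate: the running cost plus, for each possible jump, its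
    rate times the payment at this jump. *)
Definition flow_rate (h : hist R n) (s : R) : R :=
  (g (h, s) + arr_rate q * v ((last_state h).1.+1, p h s) (h, s) +
   (p h s)%:R * (last_state h).1%:R * srv_rate q * v ((last_state h).1.-1, p h s) (h, s))%R.

Definition sojourn_payoff (h : hist R n) (z : state) (s : R) : \bar R :=
  \int[leb]_(u in `]0%R, s]) (expR (- (alpha * (last_time h + u))) * g (h, u))%:E +
  (expR (- (alpha * (last_time h + s))) * v z (h, s))%:E.

(** Discounting at rate [alpha] amounts to an additional hazard of rate [alpha]. *)
Lemma hazard_killed h s : (0 <= s)%R ->
  hazard (killed h) s = (alpha * s + hazard (sojourn_rate q p h) s)%R.
Proof.
move=> s0; rewrite /hazard /killed.
have mr := measurable_sojourn_rate1 q pol h.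
rewrite RintegralD//.
- rewrite Rintegral_cst//= lebesgue_measure_itv/= lte_fin.
  case: ifPn => [_|]; first by rewrite /= subr0.
  by rewrite -leNgt => s0'; have -> : s = 0%R by apply/le_anti/andP.
- exact: (@cst_itv_integrable R 0%R s alpha).
- exact: (rate_integrable mr (arr_rate_gt0 q) (sojourn_rate_ge q p h) (sojourn_rate_le q p h)).
Qed.

Lemma measurable_killed h : measurable_fun setT (killed h).
Proof.
apply: measurable_funD; first exact: measurable_cst.
exact: measurable_sojourn_rate1.
Qed.

Lemma killed_ge h s : (alpha <= killed h s)%R.
Proof.
by rewrite /killed lerDl (le_trans _ (sojourn_rate_ge q p h s))// ltW// arr_rate_gt0.
Qed.

Lemma killed_le h s :
  (killed h s <= alpha + (arr_rate q + (last_state h).1%:R * srv_rate q))%R.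
Proof. by rewrite /killed lerD2l; exact: sojourn_rate_le. Qed.

Lemma expectation_sojourn_payoff :
  \int[P]_w sojourn_payoff (hst n w) (Z n.+1 w) (tau n w) =
  \int[P]_w \int[leb]_(s in `]0%R, +oo[)
    (expR (- (alpha * T n w)) * (expR (- hazard (killed (hst n w)) s) *
     flow_rate (hst n w) s))%:E.
Proof.
pose E (x : hist R n * R) := expR (- (alpha * (last_time x.1 + x.2))).
have mE : measurable_fun setT E.
  apply: measurableT_comp => //; apply: measurableT_comp => //.
  apply: measurable_funM; first exact: measurable_cst.
  apply: measurable_funD => //.
  exact: measurableT_comp (@measurable_last_time R n) measurable_fst.
have := @expectation_sojourn n (fun x => (E x * g x)%:E) (fun z x => (E x * v z x)%:E).
move=> ->; last 4 first.
- by apply/measurable_EFinP; exact: measurable_funM.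
- by move=> x; rewrite lee_fin mulr_ge0// expR_ge0.
- by move=> z; apply/measurable_EFinP; exact: measurable_funM.
- by move=> z x; rewrite lee_fin mulr_ge0// expR_ge0.
apply: eq_integral => w _; apply: eq_integral => s.
rewrite mem_setE in_itv/= andbT => s0.
rewrite /=; apply: (congr1 EFin).
rewrite hazard_killed ?ltW// /flow_rate last_history /E/= /last_time last_time_history.
rewrite (_ : - (alpha * (T n w + s)) = - (alpha * T n w) + - (alpha * s))%R; last by ring.
rewrite opprD !expRD.
move: (expR (- (alpha * T n w))) (expR (- (alpha * s))) (expR (- hazard _ s)) => a b c.
by ring.
Qed.

(** A flow at [killed h] times a constant [b] is worth [b], by [survival_tail]. This is
    what the payoff rates are compared with. *)
Lemma integral_killed (h : hist R n) (a b : R) : (0 <= a)%R -> (0 <= b)%R ->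
  \int[leb]_(s in `]0%R, +oo[) (a * (expR (- hazard (killed h) s) * (killed h s * b)))%:E =
  (a * b)%:E.
Proof.
move=> a0 b0.
under eq_integral.
  move=> s _.
  rewrite (_ : _ * _ = (a * b) * (killed h s * expR (- hazard (killed h) s)))%R; last by ring.
  rewrite EFinM; over.
have mk := measurable_killed h; have k0 := killed_ge h; have kC := killed_le h.
rewrite ge0_integralZl//; last 3 first.
- apply/measurable_EFinP/measurable_funTS.
  exact: (jump_density_measurable mk alpha_gt0 k0 kC).
- by move=> s _; rewrite lee_fin (jump_density_ge0 alpha_gt0 k0).
- by rewrite lee_fin mulr_ge0.
rewrite (survival_tail mk alpha_gt0 k0 kC)// hazard_neg// oppr0 expR0 mule1//.
Qed.

Lemma flow_rate_ge0 h s : (0 <= flow_rate h s)%R.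
Proof.
have [la mu] := (arr_rate_gt0 q, srv_rate_gt0 q).
by rewrite /flow_rate !addr_ge0 ?mulr_ge0// ltW.
Qed.

(** The inequality between rates is the Bellman inequality of the state at the
    beginning of the sojourn; it has to hold at every time of the sojourn, for the action
    in force at that time. *)
Lemma sojourn_payoff_ge (u : state -> R) : (forall z, 0 <= u z)%R ->
  (forall h s, (0 < s)%R ->
    ((alpha + sojourn_rate q p h s) * u (last_state h) <= flow_rate h s)%R) ->
  \int[P]_w (expR (- (alpha * T n w)) * u (Z n w))%:E <=
  \int[P]_w sojourn_payoff (hst n w) (Z n.+1 w) (tau n w).
Proof.
move=> u0 uf; rewrite expectation_sojourn_payoff; apply: ge0_le_integral_total => w.
  by rewrite lee_fin mulr_ge0// expR_ge0.
rewrite -(integral_killed (hst n w))// ?expR_ge0//; apply: ge0_le_integral_in => s.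
  rewrite /= in_itv/= => _; rewrite lee_fin !mulr_ge0 ?expR_ge0//.
  exact: le_trans (ltW alpha_gt0) (killed_ge _ _).
rewrite /= in_itv/= andbT => s0; rewrite lee_fin !ler_wpM2l ?expR_ge0//.
by rewrite -(last_history T Z n w); exact: uf.
Qed.

Lemma sojourn_payoff_le (u : state -> R) : (forall z, 0 <= u z)%R ->
  (forall h s, (0 < s)%R ->
    (flow_rate h s <= (alpha + sojourn_rate q p h s) * u (last_state h))%R) ->
  \int[P]_w sojourn_payoff (hst n w) (Z n.+1 w) (tau n w) <=
  \int[P]_w (expR (- (alpha * T n w)) * u (Z n w))%:E.
Proof.
move=> u0 uf; rewrite expectation_sojourn_payoff; apply: ge0_le_integral_total => w.
  by apply: integral_ge0 => s _; rewrite lee_fin !mulr_ge0 ?expR_ge0 ?flow_rate_ge0.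
rewrite -(integral_killed (hst n w))// ?expR_ge0//; apply: ge0_le_integral_in => s.
  by rewrite /= in_itv/= => _; rewrite lee_fin !mulr_ge0 ?expR_ge0 ?flow_rate_ge0.
rewrite /= in_itv/= andbT => s0; rewrite lee_fin !ler_wpM2l ?expR_ge0//.
by rewrite -(last_history T Z n w); exact: uf.
Qed.

End comparison.
End discounted_step.

(** * Accumulated costs and the Bellman inequalities *)

Lemma near_left_itv (R : realType) (P : R -> Prop) (s : R) :
  (\forall u \near s^'-, P u) -> exists2 t, t < s & forall u, t < u -> u < s -> P u.
Proof.
move=> /nbhs_ballP[e /= e0 eP]; exists (s - e); first by rewrite ltrBlDl ltrDr.
move=> u tu us; apply: eP => //; rewrite /ball/= ltr_distlC; apply/andP; split => //.
by rewrite (lt_trans us)// ltrDl.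
Qed.

Lemma near_rightP (R : realType) (P : R -> Prop) (s : R) :
  (\forall u \near s^'+, P u) <-> exists2 t, s < t & forall u, s < u -> u < t -> P u.
Proof.
split => [/nbhs_ballP[e /= e0 eP]|[t st tP]].
  exists (s + e); first by rewrite ltrDl.
  move=> u su ut; apply: eP => //; rewrite /ball/= ltr_distlC; apply/andP; split => //.
  by rewrite (lt_trans _ su)// ltrBlDl ltrDr.
apply/nbhs_ballP; exists (t - s) => /=; first by rewrite subr_gt0.
move=> u; rewrite /ball/= ltr_distlC [s + (t - s)]addrC subrK => /andP[_ ut] su; exact: tP.
Qed.

(** A countable union, indexed through the enumeration of the rational numbers. *)
Lemma measurable_exists_rat d (X : measurableType d) (Q : rat -> set X) :
  (forall r, measurable (Q r)) -> measurable [set x | exists r, Q r x].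
Proof.
move=> mQ.
have -> : [set x | exists r, Q r x] =
    \bigcup_k (if unpickle k is Some r then Q r else set0).
  apply/seteqP; split => [x [r Qrx]|x [k _]].
    by exists (pickle r); [exact: I|rewrite pickleK].
  by case: unpickle => // r Qrx; exists r.
by apply: bigcupT_measurable => k; case: unpickle.
Qed.

(** Whether a system found off at the last jump epoch has been started since then. The
    action may have returned to off meanwhile. *)
Definition switched_on (R : realType) (p : policy R) n (h : hist R n) (u : R) : bool :=
  ~~ (last_state h).2 && `[< exists v, [/\ 0 < v, v <= u & p n h v] >].

Section switched_on.
Context (R : realType) (p : policy R) (pol : is_policy p) (n : nat).

Lemma policy_left_constant (h : hist R n) (s : R) : 0 < s ->
  exists t, [/\ 0 <= t, t < s & forall u, t < u -> u <= s -> p h u = p h s].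
Proof.
move=> s0; have /near_left_itv[t ts tP] := pol.2 n h s s0.
exists (Num.max 0 t); split; first by rewrite le_max lexx.
  by rewrite gt_max s0.
move=> u; rewrite gt_max => /andP[_ tu]; rewrite le_eqVlt => /predU1P[->//|us].
exact: tP.
Qed.

(** By left continuity an action 1 before time [u] is also taken at a rational time
    before [u]; the time [u] itself is treated separately. *)
Lemma measurable_switched_on :
  measurable_fun setT (fun x : hist R n * R => switched_on p x.1 x.2).
Proof.
apply: measurable_and.
  apply: measurable_neg.
  exact: measurableT_comp (@measurable_last_status R n) measurable_fst.
pose Q (r : rat) : set (hist R n * R) :=
  [set x | [&& 0 < ratr r :> R, ratr r < x.2 & p x.1 (ratr r)] ].
have mQ r : measurable (Q r).
  rewrite -[Q r]setTI.
  have : measurable_fun setT (fun x : hist R n * R =>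
      [&& 0 < ratr r :> R, ratr r < x.2 & p x.1 (ratr r)]).
    apply: measurable_and; first exact: measurable_cst.
    apply: measurable_and.
      by apply: measurable_fun_ltr => //; exact: measurable_cst.
    apply: (@measurableT_comp _ _ _ _ _ _ (fun x : hist R n * R => p x.1 x.2) _
      (fun x : hist R n * R => (x.1, ratr r)) (measurable_policy pol (n := n))).
    by apply: measurable_fun_pair => //; exact: measurable_cst.
  by move/(_ measurableT [set true]); apply.
apply: (measurable_fun_bool true); rewrite setTI.
have -> : (fun x : hist R n * R => `[< exists v, [/\ 0 < v, v <= x.2 & p x.1 v] >]) @^-1` [set true] =
   [set x | exists r, Q r x] `|` [set x | (0 < x.2) && p x.1 x.2].
  apply/seteqP; split => [[h u]/= /asboolP[v [v0 vu pv]]|[h u]/=].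
    move: vu; rewrite le_eqVlt => /predU1P[<-|vu]; first by right; rewrite v0.
    left; have [t [t0 tv tP]] := policy_left_constant h v0.
    have [r] := rat_in_itvoo tv; rewrite in_itv/= => /andP[tr rv].
    exists r; rewrite /Q/= (le_lt_trans t0 tr) (lt_trans rv vu)/=.
    by rewrite tP// ltW.
  move=> [[r]|/andP[u0 pu]]; last by apply/asboolP; exists u.
  rewrite /Q/= => /and3P[r0 ru pr]; apply/asboolP; exists (ratr r); split => //.
  exact: ltW.
apply: measurableU; first exact: measurable_exists_rat.
rewrite -[X in measurable X]setTI.
have : measurable_fun setT (fun x : hist R n * R => (0 < x.2) && p x.1 x.2).
  apply: measurable_and; last exact: measurable_policy.
  by apply: measurable_fun_ltr => //; exact: measurable_cst.
by move/(_ measurableT [set true]); apply.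
Qed.

End switched_on.

(** The Bellman inequalities of the problem in which the action is constant on each
    sojourn. *)
Record subsolution (R : realType) (q : queue R) (alpha : R) (W : state -> R) : Prop := {
  sub_ge0 : forall z, 0 <= W z ;
  sub_start : forall i, W (i, false) <= start_cost q + W (i, true) ;
  sub_off : forall i, (alpha + arr_rate q) * W (i, false) <=
    hold_cost q * i%:R + arr_rate q * W (i.+1, false) ;
  sub_on : forall i,
    (alpha + arr_rate q + i%:R * srv_rate q) * W (i, true) <=
    hold_cost q * i%:R + run_cost q + arr_rate q * W (i.+1, true) +
    i%:R * srv_rate q * W (i.-1, true) }.

(** The last term is the interest on the start-up cost; the cost itself is paid at the
    end of the sojourn, in [start_payment]. *)
Definition cost_rate (R : realType) (q : queue R) (alpha : R) (p : policy R) n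
    (x : hist R n * R) : R :=
  hold_cost q * (last_state x.1).1%:R + run_cost q * (p n x.1 x.2)%:R +
  alpha * start_cost q * (switched_on p x.1 x.2)%:R.

Definition start_payment (R : realType) (q : queue R) (p : policy R) (W : state -> R) n
    (z : state) (x : hist R n * R) : R :=
  W z + start_cost q * (switched_on p x.1 x.2)%:R.

Section chain.
Context (R : realType) (q : queue R) (alpha : R) (d : measure_display) (Omega : measurableType d).
Variables (T : nat -> Omega -> R) (Z : nat -> Omega -> state).
Hypotheses (mT : forall n, measurable_fun setT (T n)).
Hypotheses (mZ : forall n, measurable_fun setT (Z n)).
Variables (p : policy R) (z0 : state) (P : probability Omega R).
Hypotheses (pol : is_policy p) (law : policy_law T Z q p z0 P).
Hypothesis alpha_gt0 : 0 < alpha.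
Local Notation leb := (@lebesgue_measure R).
Local Notation hst := (history T Z).
Local Notation tau n w := (T n.+1 w - T n w).

Lemma cost_rate_ge0 n (x : hist R n * R) : 0 <= cost_rate q alpha p x.
Proof.
have := (hold_cost_gt0 q, run_cost_gt0 q, start_cost_ge0 q) => -[[h0 c0] s0].
by rewrite !addr_ge0 ?mulr_ge0// ltW.
Qed.

Lemma measurable_bool_natr d' (X : measurableType d') (b : X -> bool) :
  measurable_fun setT b -> measurable_fun setT (fun x => (b x)%:R : R).
Proof.
move=> mb; rewrite (_ : (fun x => _) = (fun x => if b x then 1 else 0)).
  exact: measurable_fun_ifT.
by apply/funext => x; case: (b x).
Qed.

Lemma measurable_cost_rate n : measurable_fun setT (@cost_rate R q alpha p n).
Proof.
apply: measurable_funD; first apply: measurable_funD.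
- apply: measurable_funM; first exact: measurable_cst.
  apply: (@measurable_fun_nat_family _ _ _ _ (fun x : hist R n * R => (last_state x.1).1)
    (fun i _ => i%:R : R)) => //.
  exact: measurableT_comp (@measurable_last_count R n) measurable_fst.
- apply: measurable_funM; first exact: measurable_cst.
  by apply: measurable_bool_natr; exact: measurable_policy.
- apply: measurable_funM; first exact: measurable_cst.
  by apply: measurable_bool_natr; exact: measurable_switched_on.
Qed.

Lemma start_payment_ge0 W n z (x : hist R n * R) : (forall z, 0 <= W z) ->
  0 <= start_payment q p W z x.
Proof. by move=> W0; rewrite addr_ge0// mulr_ge0// start_cost_ge0. Qed.

Lemma measurable_start_payment W n z : measurable_fun setT (@start_payment R q p W n z).
Proof.
apply: measurable_funD; first exact: measurable_cst.
apply: measurable_funM; first exact: measurable_cst.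
by apply: measurable_bool_natr; exact: measurable_switched_on.
Qed.

(** The critical case is a system found off that has been started during the sojourn
    and may have been stopped again. Both [s1 + W (i, true)] and [s1 + W (i, false)] are
    at least [W (i, false)], so that the inequality follows from [sub_on] or [sub_off],
    according to the action in force, with the interest on [s1] filling the gap. *)
Lemma subsolution_flow W n (h : hist R n) s : subsolution q alpha W -> never_off p ->
  0 < s ->
  (alpha + sojourn_rate q p h s) * W (last_state h) <=
  flow_rate q p (@cost_rate R q alpha p n) (@start_payment R q p W n) h s.
Proof.
move=> [W0 Wst Woff Won] poff s0.
have h0 := hold_cost_gt0 q; have c0 := run_cost_gt0 q.
have sc0 := start_cost_ge0 q; have la := arr_rate_gt0 q; have mu := srv_rate_gt0 q.
rewrite /sojourn_rate exit_rateE /flow_rate /cost_rate /start_payment /=.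
case zE : (last_state h) => [i []] /=.
  have -> : p h s by apply: poff => //; rewrite zE.
  have -> : switched_on p h s = false by rewrite /switched_on zE.
  have := Won i; rewrite /= !mulr0 !addr0 !mulr1 mul1r.
  move: (W _) (W _) (W _) => w1 w2 w3 H; lra.
have imu : 0 <= i%:R * srv_rate q by rewrite mulr_ge0// ltW.
have [on|] := boolP (switched_on p h s); last first.
  rewrite /switched_on zE/= => /asboolPn off.
  have -> : p h s = false.
    by apply/negP => ps; apply: off; exists s.
  have := Woff i; rewrite /= !mulr0 !mul0r !addr0.
  by move: (W _) (W _) => w1 w2; lra.
case: (p h s); rewrite /= !mulr1 ?mul1r ?mul0r.
  apply: (@le_trans _ _ ((alpha + (arr_rate q + i%:R * srv_rate q)) *
    (start_cost q + W (i, true)))).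
    by rewrite ler_wpM2l ?Wst// !addr_ge0// ltW.
  have := Won i; move: (W _) (W _) (W _) => w1 w2 w3 H; lra.
rewrite ?(mulr0, addr0, mul0r).
have := Woff i; move: (W _) (W _) => w1 w2 H.
have : 0 <= alpha * start_cost q by rewrite mulr_ge0// ltW.
have : 0 <= arr_rate q * start_cost q by rewrite mulr_ge0// ltW.
lra.
Qed.

Local Open Scope ereal_scope.

Definition discounted_value (W : state -> R) n (w : Omega) : \bar R :=
  (expR (- (alpha * T n w)) * W (Z n w))%:E.

(** The terminal payment comprises the start-up cost but not the value of the next
    state, whence the value function 0. *)
Definition sojourn_cost n (w : Omega) : \bar R :=
  sojourn_payoff alpha (@cost_rate R q alpha p n) (@start_payment R q p (cst 0%R) n)
    (hst n w) (Z n.+1 w) (tau n w).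

Lemma discounted_value_ge0 W n w : (forall z, (0 <= W z)%R) -> 0 <= discounted_value W n w.
Proof. by move=> W0; rewrite lee_fin mulr_ge0// expR_ge0. Qed.

Lemma measurable_discounted_value W n : measurable_fun setT (discounted_value W n).
Proof.
apply/measurable_EFinP; apply: measurable_funM.
  apply: measurableT_comp => //; apply: measurableT_comp => //.
  by apply: measurable_funM => //; exact: measurable_cst.
by apply: (@measurable_state_family _ _ _ _ (Z n) (fun z _ => W z)).
Qed.

Lemma sojourn_cost_ge0 n w : 0 <= sojourn_cost n w.
Proof.
rewrite adde_ge0//.
  by apply: integral_ge0 => u _; rewrite lee_fin mulr_ge0 ?expR_ge0 ?cost_rate_ge0.
by rewrite lee_fin mulr_ge0 ?expR_ge0 ?start_payment_ge0.
Qed.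

Lemma measurable_discount n :
  measurable_fun setT (fun x : hist R n * R => expR (- (alpha * (last_time x.1 + x.2)))).
Proof.
apply: measurableT_comp => //; apply: measurableT_comp => //.
apply: measurable_funM; first exact: measurable_cst.
apply: measurable_funD => //.
exact: measurableT_comp (@measurable_last_time R n) measurable_fst.
Qed.

Lemma measurable_sojourn_cost n : measurable_fun setT (sojourn_cost n).
Proof.
pose I (x : hist R n * R) := \int[leb]_(u in `]0%R, x.2])
  (expR (- (alpha * (last_time x.1 + u))) * cost_rate q alpha p (x.1, u))%:E.
apply: emeasurable_funD.
  apply: (@measurableT_comp _ _ _ _ _ _ I _ (fun w => (hst n w, tau n w))); last first.
    exact: measurable_history_tau.
  apply: (@measurable_integral_itv _ _ _ snd (fun y : (hist R n * R) * R =>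
    (expR (- (alpha * (last_time y.1.1 + y.2))) * cost_rate q alpha p (y.1.1, y.2))%:E)) => //.
    apply/measurable_EFinP.
    apply: (@measurableT_comp _ _ _ _ _ _ (fun x : hist R n * R =>
      expR (- (alpha * (last_time x.1 + x.2))) * cost_rate q alpha p x)%R _
      (fun y : (hist R n * R) * R => (y.1.1, y.2))).
      by apply: measurable_funM; [exact: measurable_discount|exact: measurable_cost_rate].
    by apply: measurable_fun_pair => //; exact: measurableT_comp.
  by move=> y; rewrite lee_fin mulr_ge0 ?expR_ge0 ?cost_rate_ge0.
apply/measurable_EFinP.
apply: (@measurableT_comp _ _ _ _ _ _ (fun x : hist R n * R =>
      expR (- (alpha * (last_time x.1 + x.2))) * start_payment q p (cst 0%R) (0%N, true) x)%R _
      (fun w => (hst n w, tau n w))); last exact: measurable_history_tau.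
by apply: measurable_funM; [exact: measurable_discount|exact: measurable_start_payment].
Qed.

Lemma sojourn_payoff_split W n w :
  sojourn_payoff alpha (@cost_rate R q alpha p n) (@start_payment R q p W n)
    (hst n w) (Z n.+1 w) (tau n w) = sojourn_cost n w + discounted_value W n.+1 w.
Proof.
rewrite /sojourn_cost /sojourn_payoff; move: (\int[leb]_(u in _) _) => I.
rewrite -addeA; congr (I + _).
rewrite /discounted_value /start_payment /= add0r /last_time last_time_history.
rewrite (_ : (T n w + (T n.+1 w - T n w))%R = T n.+1 w); last by ring.
by apply: (congr1 EFin); ring.
Qed.

Lemma integral_sojourn_payoff W n : (forall z, (0 <= W z)%R) ->
  \int[P]_w sojourn_payoff alpha (@cost_rate R q alpha p n) (@start_payment R q p W n)
    (hst n w) (Z n.+1 w) (tau n w) =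
  \int[P]_w sojourn_cost n w + \int[P]_w discounted_value W n.+1 w.
Proof.
move=> W0; rewrite -ge0_integralD//.
- by apply: eq_integral => w _; exact: sojourn_payoff_split.
- by move=> w _; exact: sojourn_cost_ge0.
- exact: measurable_sojourn_cost.
- by move=> w _; exact: discounted_value_ge0.
- exact: measurable_discounted_value.
Qed.

Lemma value_step_ge W (u : state -> R) n : (forall z, (0 <= W z)%R) -> (forall z, (0 <= u z)%R) ->
  (forall h s, (0 < s)%R -> ((alpha + sojourn_rate q p h s) * u (last_state h) <=
    flow_rate q p (@cost_rate R q alpha p n) (@start_payment R q p W n) h s)%R) ->
  \int[P]_w discounted_value u n w <=
  \int[P]_w sojourn_cost n w + \int[P]_w discounted_value W n.+1 w.
Proof.
move=> W0 u0 uW; rewrite -integral_sojourn_payoff//.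
apply: (@sojourn_payoff_ge _ q _ _ _ _ _ mT mZ p z0 P pol law) => //.
- exact: measurable_cost_rate.
- exact: cost_rate_ge0.
- by move=> z; exact: measurable_start_payment.
- by move=> z x; exact: start_payment_ge0.
Qed.

Lemma value_step_le W (u : state -> R) n : (forall z, (0 <= W z)%R) -> (forall z, (0 <= u z)%R) ->
  (forall h s, (0 < s)%R ->
    (flow_rate q p (@cost_rate R q alpha p n) (@start_payment R q p W n) h s <=
    (alpha + sojourn_rate q p h s) * u (last_state h))%R) ->
  \int[P]_w sojourn_cost n w + \int[P]_w discounted_value W n.+1 w <=
  \int[P]_w discounted_value u n w.
Proof.
move=> W0 u0 uW; rewrite -integral_sojourn_payoff//.
apply: (@sojourn_payoff_le _ q _ _ _ _ _ mT mZ p z0 P pol law) => //.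
- exact: measurable_cost_rate.
- exact: cost_rate_ge0.
- by move=> z; exact: measurable_start_payment.
- by move=> z x; exact: start_payment_ge0.
Qed.

Lemma initial_ae : {ae P, forall w, T 0%N w = 0%R /\ Z 0%N w = z0}.
Proof.
have mE : measurable [set w | T 0%N w = 0%R /\ Z 0%N w = z0].
  apply: measurableI; last exact: measurable_stateP.
  rewrite -[X in measurable X]setTI; exact: (mT 0%N measurableT (measurable_set1 0%R)).
exists (~` [set w | T 0%N w = 0%R /\ Z 0%N w = z0]); split => //.
  exact: measurableC.
by rewrite probability_setC// law.1 subee.
Qed.

Lemma integral_initial_value (u : state -> R) : (forall z, (0 <= u z)%R) ->
  \int[P]_w discounted_value u 0 w = (u z0)%:E.
Proof.
move=> u0; transitivity (\int[P]_w (cst (u z0)%:E) w); last first.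
  by rewrite integral_cst// -[RHS]mule1; congr (_ * _); exact: probability_setT.
apply: ge0_ae_eq_integral => //.
- exact: measurable_discounted_value.
- by move=> w _; exact: discounted_value_ge0.
- by move=> w _ /=; rewrite lee_fin.
case: initial_ae => N [mN N0 NP]; exists N; split => // w /= h; apply: NP => -[T0 Z0].
by apply: h => _; rewrite /discounted_value T0 Z0 mulr0 oppr0 expR0 mul1r.
Qed.

Definition cost_upto n w := \sum_(k < n) sojourn_cost k w.

Lemma cost_upto_ge0 n w : 0 <= cost_upto n w.
Proof. by apply: sume_ge0 => k _; exact: sojourn_cost_ge0. Qed.

Lemma measurable_cost_upto n : measurable_fun setT (cost_upto n).
Proof. by apply: emeasurable_sum => k; exact: measurable_sojourn_cost. Qed.

Lemma integral_cost_uptoS n : \int[P]_w cost_upto n.+1 w =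
  \int[P]_w cost_upto n w + \int[P]_w sojourn_cost n w.
Proof.
rewrite -ge0_integralD//.
- by apply: eq_integral => w _; rewrite /cost_upto big_ord_recr.
- by move=> w _; exact: cost_upto_ge0.
- exact: measurable_cost_upto.
- by move=> w _; exact: sojourn_cost_ge0.
- exact: measurable_sojourn_cost.
Qed.

(** The first step may use a function [u] larger than the subsolution; this detects
    wrong decisions in the initial state. *)
Lemma first_step_lower_bound W (u : state -> R) n : subsolution q alpha W ->
  never_off p -> (forall z, (0 <= u z)%R) ->
  (forall (h : hist R 0) s, (0 < s)%R -> ((alpha + sojourn_rate q p h s) * u (last_state h) <=
    flow_rate q p (@cost_rate R q alpha p 0) (@start_payment R q p W 0) h s)%R) ->
  (u z0)%:E <= \int[P]_w cost_upto n.+1 w + \int[P]_w discounted_value W n.+1 w.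
Proof.
move=> Wsub poff u0 uW; have W0 := sub_ge0 Wsub.
elim: n => [|n IH].
  rewrite -integral_initial_value// integral_cost_uptoS.
  have -> : \int[P]_w cost_upto 0 w = 0.
    by apply: integral0_eq => w _; rewrite /cost_upto big_ord0.
  by rewrite add0e; exact: value_step_ge.
rewrite integral_cost_uptoS -addeA (le_trans IH)// leeD2l//.
by apply: value_step_ge => // h s s0; exact: subsolution_flow.
Qed.

(** If along the policy the Bellman inequalities hold in the opposite direction,
    then the iteration runs in the opposite direction, too. *)
Lemma cost_upto_upper_bound W n : (forall z, (0 <= W z)%R) ->
  (forall n (h : hist R n) s, (0 < s)%R ->
    (flow_rate q p (@cost_rate R q alpha p n) (@start_payment R q p W n) h s <=
    (alpha + sojourn_rate q p h s) * W (last_state h))%R) ->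
  \int[P]_w cost_upto n w + \int[P]_w discounted_value W n w <= (W z0)%:E.
Proof.
move=> W0 uW; elim: n => [|n IH].
  rewrite -integral_initial_value//.
  have -> : \int[P]_w cost_upto 0 w = 0.
    by apply: integral0_eq => w _; rewrite /cost_upto big_ord0.
  by rewrite add0e.
rewrite integral_cost_uptoS -addeA (le_trans _ IH)// leeD2l//.
by apply: value_step_le => // h s s0; exact: uW.
Qed.

End chain.

(** * Decay of the discounted number of customers *)

Section tail.
Context (R : realType) (q : queue R) (alpha : R) (d : measure_display) (Omega : measurableType d).
Variables (T : nat -> Omega -> R) (Z : nat -> Omega -> state).
Hypotheses (mT : forall n, measurable_fun setT (T n)).
Hypotheses (mZ : forall n, measurable_fun setT (Z n)).
Variables (p : policy R) (z0 : state) (P : probability Omega R).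
Hypotheses (pol : is_policy p) (law : policy_law T Z q p z0 P).
Hypothesis alpha_gt0 : 0 < alpha.
Local Notation leb := (@lebesgue_measure R).
Local Notation hst := (history T Z).
Local Notation tau n w := (T n.+1 w - T n w).

(** A quadratic function of the number of customers. A linear one would not do: its
    drift over a sojourn that may end in a departure does not dominate the number of
    customers, since the sojourn is shorter the more customers there are. *)
Definition lyapunov (z : state) : R :=
  let B := 3 * arr_rate q / alpha + 1 in
  z.1%:R ^+ 2 + B * z.1%:R + (arr_rate q * (1 + B) + alpha + arr_rate q) / alpha.

Definition count1 (z : state) : R := z.1.+1%:R.

Lemma lyapunov_drift (B C l m x : R) :
  0 < alpha -> 0 < l -> 0 < m -> 0 <= x -> 1 <= B ->
  alpha * B = 3 * l + alpha -> alpha * C = l * (1 + B) + alpha + l ->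
  l * ((x + 1) ^+ 2 + B * (x + 1) + C) <=
  (alpha + l) * (x ^+ 2 + B * x + C - (x + 1)).
Proof.
move=> a0 l0 m0 x0 B1 aB aC.
rewrite -subr_ge0 [leRHS](_ : _ = alpha * x ^+ 2 +
  x * (alpha * B - 3 * l - alpha) + (alpha * C - l * (1 + B) - alpha - l)); last by ring.
rewrite aB aC [leRHS](_ : _ = alpha * x ^+ 2); last by ring.
by rewrite mulr_ge0 ?sqr_ge0// ltW.
Qed.

Lemma lyapunov_departure (B C x : R) : 1 <= x -> 1 <= B ->
  (x - 1) ^+ 2 + B * (x - 1) + C <= x ^+ 2 + B * x + C - (x + 1).
Proof. move=> x1 B1; nra. Qed.

(** The drift inequality in each state: over one sojourn the discounted expectation
    loses at least the number of customers plus one. *)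
Lemma lyapunov_flow i (b : bool) :
  arr_rate q * lyapunov (i.+1, b) + b%:R * i%:R * srv_rate q * lyapunov (i.-1, b) <=
  (alpha + (arr_rate q + b%:R * i%:R * srv_rate q)) *
    (lyapunov (i, ~~ b) - count1 (i, ~~ b)).
Proof.
have l0 := arr_rate_gt0 q; have m0 := srv_rate_gt0 q.
pose B := 3 * arr_rate q / alpha + 1.
pose C := (arr_rate q * (1 + B) + alpha + arr_rate q) / alpha.
have B1 : 1 <= B by rewrite lerDr divr_ge0// ?mulr_ge0// ltW.
have aB : alpha * B = 3 * arr_rate q + alpha.
  by rewrite /B mulrDr mulr1 mulrC divfK ?gt_eqF.
have aC : alpha * C = arr_rate q * (1 + B) + alpha + arr_rate q.
  by rewrite /C mulrC divfK ?gt_eqF.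
have arr := @lyapunov_drift B C _ _ i%:R alpha_gt0 l0 m0 (ler0n _ _) B1 aB aC.
rewrite /lyapunov /count1 /= -/B -/C -(natr1 i) (addrA alpha).
rewrite (mulrDl (alpha + arr_rate q)) lerD//.
case: i {arr} => [|i]; first by rewrite !mulr0 !mul0r.
apply: ler_wpM2l; first by rewrite mulr_ge0// ltW.
have -> : i.+1.-1%:R = i.+1%:R - 1 :> R by rewrite -natr1 addrK.
by apply: lyapunov_departure => //; rewrite ler1n.
Qed.

Lemma lyapunov_ge_count1 z : count1 z <= lyapunov z.
Proof.
have l0 := arr_rate_gt0 q.
have B0 : 0 <= 3 * arr_rate q / alpha by rewrite divr_ge0 ?mulr_ge0// ltW.
have C0 : 1 <= (arr_rate q * (1 + (3 * arr_rate q / alpha + 1)) + alpha + arr_rate q) / alpha.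
  rewrite ler_pdivlMr// mul1r addrAC lerDr addr_ge0 ?mulr_ge0 ?addr_ge0//; exact: ltW.
rewrite /lyapunov /count1 -natr1; move: B0 C0.
move: (3 * arr_rate q / alpha) => B B0; move: (_ / alpha) => C C1; have := ler0n R z.1.
by move: (z.1%:R : R) => x x0; nra.
Qed.

Lemma lyapunov_ge0 z : 0 <= lyapunov z.
Proof. by apply: le_trans (lyapunov_ge_count1 z); exact: ler0n. Qed.

Local Open Scope ereal_scope.

Lemma lyapunov_step n :
  \int[P]_w discounted_value alpha T Z count1 n w +
  \int[P]_w discounted_value alpha T Z lyapunov n.+1 w <=
  \int[P]_w discounted_value alpha T Z lyapunov n w.
Proof.
have ln0 z : (0 <= lyapunov z - count1 z)%R by rewrite subr_ge0 lyapunov_ge_count1.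
have c10 z : (0 <= count1 z)%R by [].
have mdv := measurable_discounted_value alpha mT mZ.
have -> : \int[P]_w discounted_value alpha T Z lyapunov n w =
   \int[P]_w discounted_value alpha T Z count1 n w +
   \int[P]_w discounted_value alpha T Z (fun z => lyapunov z - count1 z)%R n w.
  rewrite -ge0_integralD//; last 2 first.
  - by move=> w _; exact: discounted_value_ge0.
  - by move=> w _; exact: discounted_value_ge0.
  apply: eq_integral => w _; rewrite /discounted_value -EFinD -mulrDr.
  by rewrite addrC subrK.
rewrite leeD2l//.
have H := @sojourn_payoff_le _ q alpha _ _ _ _ mT mZ p z0 P pol law alpha_gt0 n (cst 0%R)
  (fun z _ => lyapunov z) _ _ _ _ _ ln0.
apply: (le_trans _ (H _ _ _ _ _)) => //.
- rewrite le_eqVlt; apply/orP; left; apply/eqP/eq_integral => w _.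
  rewrite /sojourn_payoff integral0_eq; last by move=> u _; rewrite mulr0.
  rewrite add0e /discounted_value /last_time last_time_history.
  by rewrite (_ : (T n w + (T n.+1 w - T n w))%R = T n.+1 w)//; ring.
- by move=> z x; exact: lyapunov_ge0.
move=> h s s0; rewrite /flow_rate /sojourn_rate exit_rateE add0r.
have := lyapunov_flow (last_state h).1 (p h s).
rewrite /lyapunov/= => H'; exact: H'.
Qed.

Lemma sum_count1_bounded n :
  \sum_(k < n) \int[P]_w discounted_value alpha T Z count1 k w <= (lyapunov z0)%:E.
Proof.
suff H : \sum_(k < n) \int[P]_w discounted_value alpha T Z count1 k w +
    \int[P]_w discounted_value alpha T Z lyapunov n w <= (lyapunov z0)%:E.
  apply: le_trans H; rewrite leeDl//; apply: integral_ge0 => w _.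
  by apply: discounted_value_ge0 => z; exact: lyapunov_ge0.
elim: n => [|n IH].
  rewrite big_ord0 add0e (integral_initial_value alpha mT mZ law)//.
  exact: lyapunov_ge0.
by rewrite big_ord_recr/= -addeA (le_trans _ IH)// leeD2l// lyapunov_step.
Qed.

Lemma discounted_count1_ge0 k : 0 <= \int[P]_w discounted_value alpha T Z count1 k w.
Proof. by apply: integral_ge0 => w _; apply: discounted_value_ge0 => z; rewrite ler0n. Qed.

Lemma series_count1_bounded :
  \sum_(k <oo) \int[P]_w discounted_value alpha T Z count1 k w <= (lyapunov z0)%:E.
Proof.
apply: lime_le.
  by apply: is_cvg_nneseries => k _ _; exact: discounted_count1_ge0.
by near=> n; rewrite big_mkord; exact: sum_count1_bounded.
Unshelve. all: by end_near. Qed.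

Lemma discounted_count1_cvg0 :
  (\int[P]_w discounted_value alpha T Z count1 k w) @[k --> \oo] --> 0.
Proof.
have fin k : \int[P]_w discounted_value alpha T Z count1 k w \is a fin_num.
  rewrite ge0_fin_numE ?discounted_count1_ge0//.
  apply: (@le_lt_trans _ _ (lyapunov z0)%:E); last exact: ltry.
  apply: le_trans (sum_count1_bounded k.+1).
  by rewrite big_ord_recr/= leeDr// sume_ge0// => i _; exact: discounted_count1_ge0.
pose e k := fine (\int[P]_w discounted_value alpha T Z count1 k w).
have e0 k : (0 <= e k)%R by rewrite fine_ge0// discounted_count1_ge0.
have eE k : (e k)%:E = \int[P]_w discounted_value alpha T Z count1 k w by rewrite fineK.
rewrite (_ : (fun k => _) = EFin \o e); last by apply/funext => k /=; rewrite eE.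
apply: cvg_EFin; first by near=> k.
apply: cvg_series_cvg_0; apply: nondecreasing_is_cvgn.
  by apply/nondecreasing_seqP => n; rewrite !seriesEnat/= big_nat_recr//= lerDl.
exists (lyapunov z0) => _ [n _ <-].
rewrite seriesEnat/= big_mkord -lee_fin -sumEFin.
by under eq_bigr do rewrite eE; exact: sum_count1_bounded.
Unshelve. all: by end_near. Qed.

(** The discounted counts have a finite total expectation, hence so have the discount
    factors at the jump epochs; their sum would be infinite if the jump epochs were
    bounded. *)
Lemma series_discount_finite_ae :
  {ae P, forall w, \sum_(k <oo) (expR (- (alpha * T k w)))%:E < +oo}.
Proof.
have md k : measurable_fun setT (fun w => discounted_value alpha T Z (cst 1%R) k w).
  exact: measurable_discounted_value.
have d0 k w : 0 <= discounted_value alpha T Z (cst 1%R) k w.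
  by apply: discounted_value_ge0.
have mS : measurable_fun setT
    (fun w => \sum_(k <oo) discounted_value alpha T Z (cst 1%R) k w).
  by apply: ge0_emeasurable_sum.
have : P.-integrable setT (fun w => \sum_(k <oo) discounted_value alpha T Z (cst 1%R) k w).
  apply/integrableP; split => //.
  under eq_integral do rewrite gee0_abs ?nneseries_ge0//.
  rewrite integral_nneseries//.
  apply: (@le_lt_trans _ _ (lyapunov z0)%:E); last exact: ltry.
  apply: le_trans series_count1_bounded; apply: lee_nneseries.
    by move=> k _ _; exact: integral_ge0.
  move=> k _; apply: ge0_le_integral_in => // w _.
  by rewrite lee_fin ler_wpM2l ?expR_ge0// /count1 ler1n.
move/(integrable_ae measurableT) => [N [mN N0 NP]]; exists N; split => // w /= h.
apply: NP => /= H; apply: h; move: (H Logic.I); rewrite ge0_fin_numE; last exact: nneseries_ge0.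
by under eq_eseriesr do rewrite /discounted_value/= mulr1.
Qed.

(** The jump kernel is a density on the positive half-line, and at the sojourn time [s]
    it charges only next states whose status is the action at [s]. *)
Lemma jumps_ae n :
  {ae P, forall w, T n w < T n.+1 w /\ (Z n.+1 w).2 = p (hst n w) (tau n w)}%R.
Proof.
(* the indicator of the exceptional event; its expectation is 0 *)
pose F (z : state) (x : hist R n * R) : \bar R :=
  if ((0 < x.2)%R && (p x.1 x.2 == z.2)) then 0 else 1.
have mF z : measurable_fun setT (F z).
  apply: measurable_fun_ifT => //; apply: measurable_and.
    by apply: measurable_fun_ltr => //; exact: measurable_cst.
  have mp := measurable_policy pol (n := n).
  case: (z.2); first by under eq_fun do rewrite eqb_id; exact: mp.
  by under eq_fun do rewrite eqbF_neg; exact: measurable_neg.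
have F0 z x : 0 <= F z x by rewrite /F; case: ifP.
have := expectation_next mT mZ pol law mF F0.
rewrite [X in _ = X](_ : _ = 0); last first.
  apply: integral0_eq => w _; apply: integral0_eq => s; rewrite /= in_itv/= andbT => s0.
  by rewrite /F/= s0 eqxx/= !mule0 adde0 mule0.
move=> IF0.
have mFw : measurable_fun setT (fun w => F (Z n.+1 w) (hst n w, tau n w)).
  apply: (@measurable_state_family _ _ _ _ (Z n.+1)
    (fun z w => F z (hst n w, tau n w))) => // z.
  exact: measurableT_comp (mF z) (@measurable_history_tau _ _ _ _ _ mT mZ n).
have [N [mN N0 NP]] : ae_eq P setT (fun w => F (Z n.+1 w) (hst n w, tau n w)) (cst 0).
  apply/ae_eq_integral_abs => //; rewrite -[RHS]IF0; apply: eq_integral => w _.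
  by rewrite gee0_abs.
exists N; split => // w /= h; apply: NP => /= H; apply: h.
move: (H Logic.I); rewrite /F/= subr_gt0; case: ifPn => [/andP[? /eqP ->]//|_ /eqP].
by rewrite onee_eq0.
Qed.

End tail.

(** * Costs along a single trajectory *)

Lemma esum_subset (R : realType) (I : choiceType) (A B : set I) (a : I -> \bar R) :
  A `<=` B -> (forall i, B i -> 0 <= a i)%E ->
  (\esum_(i in A) a i <= \esum_(i in B) a i)%E.
Proof.
move=> AB a0; rewrite [leRHS](esumID A)// setIidr// leeDl// esum_ge0// => i [Bi _]; exact: a0.
Qed.

Lemma le_nneseries_term (R : realType) (f : nat -> \bar R) n :
  (forall k, 0 <= f k)%E -> (f n <= \sum_(k <oo) f k)%E.
Proof.
move=> f0; rewrite (nneseries_split 0 n.+1 (fun k _ => f0 k)) big_nat_recr//=.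
rewrite -addeA addeCA leeDl// adde_ge0 ?sume_ge0// nneseries_ge0//.
Qed.

(** Used for the first start-up within a sojourn. *)
Lemma finite_set_min (R : realType) (A : set R) (x : R) : finite_set A -> A x ->
  exists2 m, A m & forall y, A y -> m <= y.
Proof.
move=> /finite_seqP[s ->] {A} /=; elim: s x => [//|a s IH] x _.
have [->|[b sb]] : s = [::] \/ exists b, b \in s.
- case: s {IH} => [|b s]; [by left|right; exists b; rewrite inE eqxx//].
- by exists a; rewrite /= ?inE// => y; rewrite inE => /eqP ->.
have [m ms mP] := IH _ sb.
exists (Num.min a m) => [/=|y /=]; rewrite inE.
  by rewrite /Num.min; case: ifP; rewrite ?eqxx// ms orbT.
by case/predU1P => [->|/mP]; rewrite ge_min ?lexx// => ->; rewrite orbT.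
Qed.

Lemma hazard_cst (R : realType) (a s : R) : 0 <= s -> hazard (cst a) s = a * s.
Proof.
move=> s0; rewrite /hazard Rintegral_cst//= lebesgue_measure_itv/= lte_fin.
case: ifPn => [_|]; first by rewrite /= subr0.
by rewrite -leNgt => s0'; have -> : s = 0 by apply/le_anti/andP.
Qed.

Lemma integral_discount (R : realType) (alpha a r s : R) : 0 < alpha -> 0 <= r -> r <= s ->
  (\int[lebesgue_measure]_(u in `]r, s]) (alpha * expR (- (alpha * (a + u))))%:E =
   (expR (- (alpha * (a + r))) - expR (- (alpha * (a + s))))%:E)%E.
Proof.
move=> alpha0 r0 rs.
have mc : measurable_fun setT (cst alpha : R -> R) by exact: measurable_cst.
have lec (u : R) : alpha <= cst alpha u by [].
have gec (u : R) : cst alpha u <= alpha by [].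
transitivity (\int[lebesgue_measure]_(u in `]r, s])
   ((expR (- (alpha * a)))%:E * (cst alpha u * expR (- hazard (cst alpha) u))%:E))%E.
  apply: eq_integral => u; rewrite mem_setE in_itv/= => /andP[ru _].
  rewrite hazard_cst; last exact: le_trans r0 (ltW ru).
  rewrite -EFinM; congr EFin; rewrite mulrDr opprD expRD /=; ring.
rewrite ge0_integralZl//; last 2 first.
- apply/measurable_EFinP/measurable_funTS.
  exact: (jump_density_measurable mc alpha0 lec gec).
- by move=> u _; rewrite lee_fin (jump_density_ge0 alpha0 lec).
have -> : (\int[lebesgue_measure]_(u in `]r, s])
    (cst alpha u * expR (- hazard (cst alpha) u))%:E =
    (expR (- hazard (cst alpha) r) - expR (- hazard (cst alpha) s))%:E)%E.
  rewrite -(survival_decrement mc alpha0 lec gec r0 rs) /Rintegral fineK//.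
  apply: integrable_fin_num => //.
  exact: (jump_density_integrable mc alpha0 lec gec).
rewrite !hazard_cst//; last exact: le_trans rs.
rewrite -EFinM; congr EFin; rewrite mulrBr -!expRD -!opprD -!mulrDr//.
Qed.

Section path.
Context (R : realType) (q : queue R) (alpha : R) (d : measure_display) (Omega : measurableType d).
Variables (T : nat -> Omega -> R) (Z : nat -> Omega -> state).
Variables (p : policy R) (w : Omega).
Hypothesis pol : is_policy p.
Hypothesis alpha_gt0 : 0 < alpha.
Hypothesis T0 : T 0%N w = 0.
Hypothesis T_lt : forall n, T n w < T n.+1 w.
Hypothesis Z_act : forall n, (Z n.+1 w).2 = p (history T Z n w) (T n.+1 w - T n w).
Local Notation leb := (@lebesgue_measure R).
Local Notation hst := (history T Z).
Local Notation t n := (T n w).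
Local Notation tau n := (T n.+1 w - T n w).
Local Notation act := (action T Z p w).
Local Notation sw := (switchings T Z p w).

Lemma epoch_le m n : (m <= n)%N -> t m <= t n.
Proof.
move=> /subnK <-; elim: (n - m)%N => [|k IH]; first by rewrite add0n.
by rewrite addSn (le_trans IH)// ltW.
Qed.

Lemma epoch_ge0 n : 0 <= t n.
Proof. by rewrite -T0 epoch_le. Qed.

Lemma sojourn_uniq_co m n s : t m <= s < t m.+1 -> t n <= s < t n.+1 -> m = n.
Proof.
move=> /andP[ms sm] /andP[ns sn]; apply/eqP; rewrite eqn_leq.
apply/andP; split; rewrite leqNgt; apply/negP => h.
  by move: (lt_le_trans sn (le_trans (epoch_le h) ms)); rewrite ltxx.
by move: (lt_le_trans sm (le_trans (epoch_le h) ns)); rewrite ltxx.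
Qed.

Lemma sojourn_uniq_oc m n s : t m < s <= t m.+1 -> t n < s <= t n.+1 -> m = n.
Proof.
move=> /andP[ms sm] /andP[ns sn]; apply/eqP; rewrite eqn_leq.
apply/andP; split; rewrite leqNgt; apply/negP => h.
  by move: (lt_le_trans ms (le_trans sn (epoch_le h))); rewrite ltxx.
by move: (lt_le_trans ns (le_trans sm (epoch_le h))); rewrite ltxx.
Qed.

Lemma customersE n s : t n <= s < t n.+1 -> customers T Z w s = (Z n w).1.
Proof.
move=> ns; rewrite /customers (@xget_subset1 _ _ _ n)//.
by move=> k l /= ks ls; exact: sojourn_uniq_co ks ls.
Qed.

Lemma actionE n s : t n < s <= t n.+1 -> act s = p (hst n w) (s - t n).
Proof.
move=> ns; rewrite /action.
have -> : 0 < s by rewrite (le_lt_trans (epoch_ge0 n))//; case/andP: ns.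
rewrite (@xget_subset1 _ _ _ n)//.
by move=> k l /= ks ls; exact: sojourn_uniq_oc ks ls.
Qed.

Lemma action_epoch n : act (t n) = (Z n w).2.
Proof.
case: n => [|n]; first by rewrite T0 /action ltxx.
by rewrite (@actionE n) ?T_lt ?lexx// Z_act.
Qed.

(** The supremum [r] of the times at which the system is off, up to a time [v] at which
    it is on, is a switching time: the system is off at [r] by left continuity, and on
    at all later times up to [v]. *)
Lemma switch_on_before n v : (Z n w).2 = false -> 0 < v -> v <= tau n ->
  p (hst n w) v -> exists r, [/\ 0 <= r, r < v, sw (t n + r) & action_right T Z p w (t n + r)].
Proof.
move=> Zn v0 vt pv.
pose E := [set x | 0 <= x <= v /\ ~~ act (t n + x)].
have E0 : E 0 by split; [rewrite lexx ltW|rewrite addr0 action_epoch Zn].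
have hE : has_sup E.
  split; first by exists 0.
  by exists v => x [/andP[]].
pose r := sup E.
have r0 : 0 <= r by exact: (ub_le_sup hE.2).
have rv : r <= v by apply: (ge_sup hE.1) => x [/andP[]].
have actb x : 0 < x -> x <= v -> act (t n + x) = p (hst n w) x.
  move=> x0 xv; rewrite (@actionE n); first by rewrite addrC addKr.
  by rewrite ltrDl x0/= -lerBrDl (le_trans xv).
have ar : act (t n + r) = false.
  apply/negP => ar.
  have rn0 : 0 < r.
    rewrite lt_neqAle r0 andbT; apply/eqP => r00.
    by move: ar; rewrite -r00 addr0 action_epoch Zn.
  have [y [y0 yr yP]] := policy_left_constant pol (hst n w) rn0.
  have : r <= y.
    apply: (ge_sup hE.1) => x [/andP[x0 xv] ax].
    rewrite leNgt; apply/negP => yx.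
    have xr : x <= r by apply: (ub_le_sup hE.2); split; rewrite ?x0.
    by move: ax; rewrite actb ?(le_lt_trans y0)// yP// -actb ?ar// (le_trans xr).
  by rewrite leNgt yr.
have rv' : r < v.
  rewrite lt_neqAle rv andbT; apply/eqP => rv'.
  by move: ar; rewrite rv' actb// pv.
have on x : r < x -> x <= v -> act (t n + x).
  move=> rx xv; apply/negPn/negP => ax.
  have : x <= r.
    by apply: (ub_le_sup hE.2); split => //; rewrite xv (le_trans r0)// ltW.
  by rewrite leNgt rx.
have right : action_right T Z p w (t n + r).
  apply/asboolP/near_rightP; exists (t n + v); first by rewrite ltrD2l.
  move=> u ru uv; rewrite (_ : u = t n + (u - t n)); last by rewrite addrC subrK.
  by apply: on; rewrite ?ltrBrDl ?lerBlDl// ltW.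
exists r; split => //; split; first by rewrite addr_ge0// epoch_ge0.
by rewrite right ar.
Qed.

(** The minimum over the finitely many switching times provided by
    [switch_on_before]. Any time at which the start-up has taken place lies after one of
    them, hence after the minimum. *)
Lemma first_switch_on n : finite_set (sw `&` `[0, t n.+1]) -> (Z n w).2 = false ->
  switched_on p (hst n w) (tau n) ->
  exists r, [/\ 0 <= r, r < tau n, sw (t n + r), action_right T Z p w (t n + r) &
    forall u, 0 < u -> u <= tau n -> switched_on p (hst n w) u -> r < u].
Proof.
move=> fin Zn; rewrite /switched_on last_history Zn/= => /asboolP[v [v0 vt pv]].
pose A := [set s | [/\ t n <= s, s < t n.+1, sw s & action_right T Z p w s]].
have finA : finite_set A.
  apply: sub_finite_set fin => s [ns sn sws _]; split => //.
  by rewrite /= in_itv/= (ltW sn) (le_trans (epoch_ge0 n)).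
have inA r : 0 <= r -> r < tau n -> sw (t n + r) -> action_right T Z p w (t n + r) -> A (t n + r).
  by move=> r0 rt *; split; rewrite // ?lerDl// -ltrBrDl.
have [r [r0 rv swr rr]] := switch_on_before Zn v0 vt pv.
have [m [nm mn swm mr] mP] := finite_set_min finA (inA _ r0 (lt_le_trans rv vt) swr rr).
have mE : t n + (m - t n) = m by rewrite addrC subrK.
exists (m - t n); rewrite mE; split => //; first by rewrite subr_ge0.
  by rewrite ltrD2r.
move=> u u0 ut /asboolP[v' [v'0 v'u pv']].
have [r' [r'0 r'v' swr' rr']] := switch_on_before Zn v'0 (le_trans v'u ut) pv'.
rewrite (lt_le_trans _ v'u)// (le_lt_trans _ r'v')// lerBlDl.
apply: mP; apply: inA => //; exact: lt_le_trans r'v' (le_trans v'u ut).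
Qed.

Local Open Scope ereal_scope.

Definition running_flow n (u : R) : R :=
  (expR (- (alpha * (t n + u))) *
    (hold_cost q * (Z n w).1%:R + run_cost q * (p (hst n w) u)%:R))%R.

Definition start_flow n (u : R) : R :=
  (start_cost q * (switched_on p (hst n w) u)%:R * (alpha * expR (- (alpha * (t n + u)))))%R.

Lemma running_flow_ge0 n u : (0 <= running_flow n u)%R.
Proof.
rewrite mulr_ge0 ?expR_ge0// addr_ge0// mulr_ge0// ltW//.
  exact: hold_cost_gt0.
exact: run_cost_gt0.
Qed.

Lemma start_flow_ge0 n u : (0 <= start_flow n u)%R.
Proof. by rewrite !mulr_ge0 ?expR_ge0 ?start_cost_ge0// ltW. Qed.

Lemma measurable_discount_shift (a : R) : measurable_fun setT (fun u => expR (- (alpha * (a + u)))).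
Proof.
apply: measurableT_comp => //; apply: measurableT_comp => //.
apply: measurable_funM; first exact: measurable_cst.
by apply: measurable_funD; [exact: measurable_cst|exact: measurable_id].
Qed.

Lemma measurable_running_flow n : measurable_fun setT (running_flow n).
Proof.
apply: measurable_funM; first exact: measurable_discount_shift.
apply: measurable_funD; first exact: measurable_cst.
apply: measurable_funM; first exact: measurable_cst.
apply: measurable_bool_natr.
exact: measurableT_comp (measurable_policy pol (n := n)) (pair1_measurable (hst n w)).
Qed.

Lemma measurable_start_flow n : measurable_fun setT (start_flow n).
Proof.
apply: measurable_funM.
  apply: measurable_funM; first exact: measurable_cst.
  apply: measurable_bool_natr.
  exact: measurableT_comp (measurable_switched_on pol (n := n)) (pair1_measurable (hst n w)).
by apply: measurable_funM; [exact: measurable_cst|exact: measurable_discount_shift].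
Qed.

Definition starting n : \bar R :=
  \int[leb]_(u in `]0%R, tau n]) (start_flow n u)%:E +
  (start_cost q * (switched_on p (hst n w) (tau n))%:R * expR (- (alpha * t n.+1)))%:E.

Lemma starting_ge0 n : 0 <= starting n.
Proof.
rewrite adde_ge0//; first by apply: integral_ge0 => u _; rewrite lee_fin start_flow_ge0.
by rewrite lee_fin !mulr_ge0 ?expR_ge0// start_cost_ge0.
Qed.

Lemma sojourn_cost_decomposition n : sojourn_cost q alpha T Z p n w =
  \int[leb]_(u in `]0%R, tau n]) (running_flow n u)%:E + starting n.
Proof.
rewrite /sojourn_cost /sojourn_payoff /starting addeA; congr (_ + _)%E; last first.
  congr EFin; rewrite /start_payment /= add0r mulrC /last_time last_time_history.
  by rewrite (addrC (t n)) subrK.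
rewrite -ge0_integralD//.
- apply: eq_integral => u _; rewrite -EFinD; congr EFin.
  rewrite /cost_rate /running_flow /start_flow/= last_history /last_time last_time_history.
  by ring.
- by move=> u _; rewrite lee_fin running_flow_ge0.
- by apply/measurable_EFinP/measurable_funTS; exact: measurable_running_flow.
- by move=> u _; rewrite lee_fin start_flow_ge0.
- by apply/measurable_EFinP/measurable_funTS; exact: measurable_start_flow.
Qed.

Lemma starting_eq0 n : switched_on p (hst n w) (tau n) = false -> starting n = 0.
Proof.
move=> off; rewrite /starting off mulr0 mul0r adde0 integral0_eq// => u.
rewrite /= in_itv/= => /andP[u0 ut]; rewrite /start_flow.
have -> : switched_on p (hst n w) u = false; last by rewrite mulr0 mul0r.
apply/negP => /andP[zn /asboolP[v [v0 vu pv]]].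
move/negP: off; apply; rewrite /switched_on zn /=; apply/asboolP; exists v; split => //.
exact: le_trans ut.
Qed.

(** Paying [s1] at the end of the sojourn and interest at rate [alpha * s1] since the
    start-up has the same discounted value as paying [s1] at the start-up. *)
Lemma starting_le n r : (0 <= r)%R -> (r < tau n)%R ->
  (forall u, (0 < u)%R -> (u <= tau n)%R -> switched_on p (hst n w) u -> (r < u)%R) ->
  starting n <= (expR (- (alpha * (t n + r))) * start_cost q)%:E.
Proof.
move=> r0 rt rP; have s10 := start_cost_ge0 q.
have H : \int[leb]_(u in `]0%R, tau n]) (start_flow n u)%:E <=
   (start_cost q)%:E * (expR (- (alpha * (t n + r))) - expR (- (alpha * (t n + tau n))))%:E.
  rewrite -(integral_discount (t n) alpha_gt0 r0 (ltW rt)) -ge0_integralZl//; last 2 first.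
  - apply/measurable_EFinP/measurable_funTS; apply: measurable_funM.
      exact: measurable_cst.
    exact: measurable_discount_shift.
  - by move=> u _; rewrite lee_fin mulr_ge0 ?expR_ge0// ltW.
  rewrite [leLHS]integral_mkcond [leRHS]integral_mkcond; apply: ge0_le_integral_total => u.
    by apply: erestrict_ge0 => ? _; rewrite lee_fin start_flow_ge0.
  rewrite !patchE !mem_setE !in_itv/=; case: ifPn => [/andP[u0 ut]|_]; last first.
    by case: ifPn => // _; rewrite mule_ge0// lee_fin// mulr_ge0 ?expR_ge0// ltW.
  rewrite ut andbT /start_flow; case: ifPn => [_|ru].
    rewrite -EFinM lee_fin; apply: ler_wpM2r.
      by rewrite mulr_ge0 ?expR_ge0// ltW.
    by rewrite ler_piMr//; case: switched_on.
  rewrite (_ : switched_on p (hst n w) u = false) ?mulr0 ?mul0r//.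
  by apply/negP => /(rP _ u0 ut); apply/negP.
apply: (le_trans (leeD2r _ H)).
have tE : (t n + tau n = t n.+1)%R by rewrite addrC subrK.
rewrite tE; apply: (@le_trans _ _ (start_cost q * (expR (- (alpha * (t n + r))) -
  expR (- (alpha * t n.+1))) + start_cost q * (switched_on p (hst n w) (tau n))%:R *
  expR (- (alpha * t n.+1)))%:E); first exact: lexx.
rewrite lee_fin mulrBr.
have : (start_cost q * (switched_on p (hst n w) (tau n))%:R * expR (- (alpha * t n.+1)) <=
  start_cost q * expR (- (alpha * t n.+1)))%R.
  rewrite ler_wpM2r ?expR_ge0// ler_piMr//; by case: switched_on.
rewrite (mulrC (expR _) (start_cost q)).
by move=> le; rewrite -addrA gerDl addrC subr_le0.
Qed.

Definition switching_term (s : R) : \bar R :=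
  (expR (- (alpha * s)) * switch_cost q (action_right T Z p w s))%:E.

Lemma switching_term_ge0 s : 0 <= switching_term s.
Proof.
rewrite lee_fin mulr_ge0 ?expR_ge0// /switch_cost.
by case: ifP => _; [exact: start_cost_ge0|exact: shut_cost_ge0].
Qed.

(** The start-up at the first switching time of the sojourn is one of the atoms of the
    cost; all others are dropped. *)
Lemma starting_le_esum n : finite_set (sw `&` `[0%R, t n.+1]) ->
  starting n <= \esum_(s in sw `&` [set s | t n <= s < t n.+1]%R) switching_term s.
Proof.
move=> fin; case son : (switched_on p (hst n w) (tau n)); last first.
  by rewrite starting_eq0// esum_ge0// => s _; exact: switching_term_ge0.
have Zn : (Z n w).2 = false.
  by apply/negbTE; move: son; rewrite /switched_on last_history => /andP[].
have [r [r0 rt swr rr rP]] := first_switch_on fin Zn son.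
apply: (le_trans (starting_le r0 rt rP)).
rewrite (_ : (_ * _)%:E = switching_term (t n + r)); last first.
  by rewrite /switching_term rr.
rewrite -(esum_set1 (switching_term_ge0 (t n + r))).
apply: esum_subset; last by move=> s _; exact: switching_term_ge0.
by move=> _ ->; split => //=; rewrite lerDl r0/= -ltrBrDl.
Qed.

Definition path_flow (s : R) : R :=
  (expR (- (alpha * s)) * (hold_cost q * (customers T Z w s)%:R + run_cost q * (act s)%:R))%R.

Lemma path_costE : path_cost T Z q alpha p w =
  \int[leb]_(s in `[0%R, +oo[) (path_flow s)%:E + \esum_(s in sw) switching_term s.
Proof. by []. Qed.

Lemma path_flow_ge0 s : (0 <= path_flow s)%R.
Proof.
rewrite mulr_ge0 ?expR_ge0// addr_ge0// mulr_ge0// ltW//.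
  exact: hold_cost_gt0.
exact: run_cost_gt0.
Qed.

Lemma path_flowE n s : (t n < s)%R -> (s < t n.+1)%R -> path_flow s = running_flow n (s - t n).
Proof.
move=> ns sn; rewrite /path_flow /running_flow (@customersE n) ?(ltW ns)//.
by rewrite (@actionE n) ?ns ?ltW// (_ : (t n + (s - t n))%R = s)// addrC subrK.
Qed.

(** Restricted to the open interval: at the jump epochs the number of customers and
    the left-continuous action do not belong to the same sojourn. *)
Definition sojourn_flow n (s : R) : \bar R :=
  ((fun s => (running_flow n (s - t n))%:E) \_ `]t n, t n.+1[%classic) s.

Lemma sojourn_flowE n s : sojourn_flow n s =
  if (t n < s < t n.+1)%R then (path_flow s)%:E else 0.
Proof.
rewrite /sojourn_flow patchE mem_setE in_itv/=; case: ifPn => // /andP[ns sn].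
by rewrite -path_flowE.
Qed.

Lemma sojourn_flow_ge0 n s : 0 <= sojourn_flow n s.
Proof. by rewrite sojourn_flowE; case: ifP => // _; rewrite lee_fin path_flow_ge0. Qed.

Lemma measurable_running_flow_shift n :
  measurable_fun setT (fun s : R => (running_flow n (s - t n))%:E).
Proof.
apply/measurable_EFinP; apply: (measurableT_comp (measurable_running_flow n)).
by apply: measurable_funB => //; exact: measurable_cst.
Qed.

Lemma measurable_sojourn_flow n : measurable_fun setT (sojourn_flow n).
Proof.
apply/(measurable_restrictT _ _).1; first exact: measurable_itv.
exact: measurable_funTS (measurable_running_flow_shift n).
Qed.

Lemma integral_sojourn_flow n :
  \int[leb]_s sojourn_flow n s = \int[leb]_(u in `]0%R, tau n]) (running_flow n u)%:E.
Proof.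
have r0 (s : R) : 0 <= (running_flow n (s - t n))%:E by rewrite lee_fin running_flow_ge0.
have mrs := measurable_running_flow_shift n.
have mD : measurable (`]t n, t n.+1[%classic : set R) by exact: measurable_itv.
rewrite -[LHS]integral_mkcond.
rewrite (ge0_integral_shift (t n) mD mrs r0).
rewrite (_ : [set x | `]t n, t n.+1[%classic (t n + x)%R] = `]0%R, tau n[%classic); last first.
  by apply/seteqP; split => x /=; rewrite !in_itv/= ltrDl ltrBrDl.
rewrite integral_itv_bndo_bndc; last first.
  apply: measurable_funTS; apply: (measurableT_comp (measurable_running_flow_shift n)).
  by apply: measurable_funD => //; exact: measurable_cst.
by apply: eq_integral => u _; rewrite (addrC (t n)) addrK.
Qed.

(** The sojourns are disjoint. *)
Lemma sojourn_flow_le n s : \sum_(k < n) sojourn_flow k s <=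
  ((EFin \o path_flow) \_ `[0%R, +oo[) s.
Proof.
have [[k kn ks]|no] := pselect (exists2 k, (k < n)%N & (t k < s < t k.+1)%R).
  rewrite (bigD1 (Ordinal kn))//= big1 ?adde0; last first.
    move=> [j jn] /=; rewrite -val_eqE/= sojourn_flowE => jk; case: ifPn => // js.
    exfalso; move/eqP: jk; apply; apply: (@sojourn_uniq_oc _ _ s).
      by case/andP: js => -> /ltW ->.
    by case/andP: ks => -> /ltW ->.
  rewrite sojourn_flowE ks patchE mem_setE in_itv/= andbT.
  by rewrite (le_trans (epoch_ge0 k))// ltW//; case/andP: ks.
rewrite big1; first by apply: erestrict_ge0 => ? _; rewrite lee_fin path_flow_ge0.
move=> [k kn] _ /=; rewrite sojourn_flowE; case: ifPn => // ks.
by exfalso; apply: no; exists k.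
Qed.

Lemma running_sum_le n :
  \sum_(k < n) \int[leb]_(u in `]0%R, tau k]) (running_flow k u)%:E <=
  \int[leb]_(s in `[0%R, +oo[) (path_flow s)%:E.
Proof.
under eq_bigr do rewrite -integral_sojourn_flow.
rewrite -(@ge0_integral_sum _ _ _ lebesgue_measure setT measurableT 'I_n
  (fun k s => sojourn_flow k s))//; last 2 first.
- by move=> k; exact: measurable_sojourn_flow.
- by move=> k s _; exact: sojourn_flow_ge0.
rewrite [leRHS]integral_mkcond; apply: ge0_le_integral_total => s.
  by apply: sume_ge0 => k _; exact: sojourn_flow_ge0.
exact: sojourn_flow_le.
Qed.

Lemma starting_sum_le n : (forall k, finite_set (sw `&` `[0%R, t k])) ->
  \sum_(k < n) starting k <= \esum_(s in sw) switching_term s.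
Proof.
move=> fin; apply: (@le_trans _ _ (\esum_(s in sw `&` [set s | (s < t n)%R]) switching_term s)).
  elim: n => [|n IH].
    by rewrite big_ord0 esum_ge0// => s _; exact: switching_term_ge0.
  rewrite big_ord_recr/= (esumID [set s | (s < t n)%R]); last first.
    by move=> s _; exact: switching_term_ge0.
  apply: leeD.
    apply: (le_trans IH); apply: esum_subset; last by move=> s _; exact: switching_term_ge0.
    by move=> s [sws sn]; split => //; split => //=; exact: lt_trans (T_lt n).
  apply: (le_trans (starting_le_esum (fin n.+1))).
  apply: esum_subset; last by move=> s _; exact: switching_term_ge0.
  by move=> s [sws /andP[ns sn]]; split => //=; apply/negP; rewrite -leNgt.
by apply: esum_subset => [s []//|s _]; exact: switching_term_ge0.
Qed.

Lemma cost_upto_le_path_cost n : (forall k, finite_set (sw `&` `[0%R, t k])) ->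
  cost_upto q alpha T Z p n w <= path_cost T Z q alpha p w.
Proof.
move=> fin; rewrite path_costE /cost_upto.
under eq_bigr do rewrite sojourn_cost_decomposition.
by rewrite big_split/=; apply: leeD; [exact: running_sum_le|exact: starting_sum_le].
Qed.

Section stationary_path.
Variable phi : state -> bool.
Hypothesis p_stat : forall n (h : hist R n) u, p h u = phi (last_state h).
Hypothesis phi_on : forall i, phi (i, true).
Hypothesis T_unbounded : forall s, exists n, (s < t n)%R.

Lemma sojourn_ex s : (0 <= s)%R -> exists n, (t n <= s < t n.+1)%R.
Proof.
move=> s0; case: (ex_minnP (T_unbounded s)) => -[|n].
  by rewrite T0 ltNge s0.
move=> sn nP; exists n; rewrite sn andbT leNgt; apply/negP => /nP.
by rewrite ltnn.
Qed.

Lemma stationary_status n : (Z n.+1 w).2 = phi (Z n w).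
Proof. by rewrite Z_act p_stat last_history. Qed.

Lemma stationary_stays_on m n : (m < n)%N -> phi (Z m w) -> (Z n w).2.
Proof.
move=> + on; elim: n => [//|n IH]; rewrite ltnS leq_eqVlt => /predU1P[<-|/IH].
  by rewrite stationary_status.
by rewrite stationary_status; case: (Z n w) => i [] //= _; exact: phi_on.
Qed.

Lemma stationary_action_right n s : (t n <= s)%R -> (s < t n.+1)%R ->
  action_right T Z p w s = phi (Z n w).
Proof.
move=> ns sn.
have actr u : (s < u)%R -> (u < t n.+1)%R -> act u = phi (Z n w).
  move=> su un; rewrite (@actionE n) ?p_stat ?last_history//.
  by rewrite (le_lt_trans ns)//= ltW.
apply/asboolP/idP => [/near_rightP[u su uP]|on]; last first.
  by apply/near_rightP; exists (t n.+1) => // u su un; rewrite actr.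
have /= := midf_lt (_ : s < Num.min u (t n.+1))%R; rewrite lt_min su sn => /(_ isT)[].
rewrite lt_min; set v := (_ / _)%R => sv /andP[vu vn].
by rewrite -(actr v)//; exact: uP.
Qed.

Lemma stationary_switching s : sw s ->
  exists n, [/\ s = t n, (Z n w).2 = false & phi (Z n w)].
Proof.
move=> [s0]; have [n /andP[ns sn]] := sojourn_ex s0.
rewrite (stationary_action_right ns sn) => h; exists n.
have st : s = t n.
  apply/eqP; rewrite eq_le ns andbT leNgt; apply/negP => ns'.
  by move: h; rewrite (@actionE n) ?ns' ?ltW// p_stat last_history eqxx.
move: h; rewrite st action_epoch; split => //.
  by apply/negP => zn; move: h; case: (Z n w) zn => i [] //= _; rewrite phi_on.
by move: h; case zn : (Z n w) => [i []] /=; [rewrite phi_on|case: phi].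
Qed.

(** After a start-up the status stays on, so that a second start-up is impossible. *)
Lemma stationary_switching_uniq r s : sw r -> sw s -> r = s.
Proof.
move=> /stationary_switching[m [-> zm pm]] /stationary_switching[n [-> zn pn]].
suff -> : m = n by [].
apply/eqP; rewrite eqn_leq; apply/andP; split; rewrite leqNgt; apply/negP => h.
  by move: zm; rewrite (stationary_stays_on h pn).
by move: zn; rewrite (stationary_stays_on h pm).
Qed.

Lemma stationary_finite_switchings (A : set R) : finite_set (sw `&` A).
Proof.
have [[s sws]|no] := pselect (exists s, sw s).
  apply: (@sub_finite_set _ _ [set s]) => // r [swr _].
  exact: stationary_switching_uniq.
by apply: (@sub_finite_set _ _ set0) => // r [swr _]; apply: no; exists r.
Qed.

Lemma stationary_starting n : (Z n w).2 = false -> phi (Z n w) ->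
  starting n = (expR (- (alpha * t n)) * start_cost q)%:E.
Proof.
move=> zn on; have tau0 : (0 < tau n)%R by rewrite subr_gt0.
have son u : (0 < u)%R -> switched_on p (hst n w) u.
  move=> u0; rewrite /switched_on last_history zn/=; apply/asboolP.
  by exists u; split => //; rewrite p_stat last_history.
rewrite /starting son// mulr1.
rewrite [X in X + _](_ : _ = (start_cost q)%:E *
   (expR (- (alpha * (t n + 0))) - expR (- (alpha * (t n + tau n))))%:E); last first.
  rewrite -(integral_discount (t n) alpha_gt0 (lexx _) (ltW tau0)) -ge0_integralZl//; last 3 first.
  - apply/measurable_EFinP/measurable_funTS; apply: measurable_funM.
      exact: measurable_cst.
    exact: measurable_discount_shift.
  - by move=> u _; rewrite lee_fin mulr_ge0 ?expR_ge0// ltW.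
  - by rewrite lee_fin start_cost_ge0.
  apply: eq_integral => u; rewrite mem_setE in_itv/= => /andP[u0 _].
  by rewrite /start_flow son// mulr1.
rewrite addr0 (_ : (t n + tau n)%R = t n.+1); last by rewrite addrC subrK.
by rewrite -EFinM -EFinD; congr EFin; ring.
Qed.

Lemma stationary_esum_le :
  \esum_(s in sw) switching_term s <= \sum_(k <oo) starting k.
Proof.
have [[s sws]|no] := pselect (exists s, sw s); last first.
  rewrite esum1 ?nneseries_ge0// => [k _ _|r swr]; first exact: starting_ge0.
  by exfalso; apply: no; exists r.
have [n [st zn on]] := stationary_switching sws.
rewrite (_ : sw = [set s]); last first.
  apply/seteqP; split => [r swr|r ->//]; exact: stationary_switching_uniq.
rewrite esum_set1 ?switching_term_ge0// /switching_term st.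
rewrite (stationary_action_right (lexx _) (T_lt n)) on -stationary_starting//.
by apply: le_nneseries_term => k; exact: starting_ge0.
Qed.

(** As the jump epochs tend to infinity, the sojourns cover the half-line up to the
    countably many jump epochs. *)
Lemma stationary_running_le :
  \int[leb]_(s in `[0%R, +oo[) (path_flow s)%:E <=
  \sum_(k <oo) \int[leb]_(u in `]0%R, tau k]) (running_flow k u)%:E.
Proof.
under eq_eseriesr do rewrite -integral_sojourn_flow.
rewrite -(integral_nneseries lebesgue_measure measurableT
  (fun k => measurable_sojourn_flow k)); last first.
  by move=> k s _; exact: sojourn_flow_ge0.
rewrite [leLHS]integral_mkcond; apply: ae_ge0_le_integral_measr.
- by apply: ge0_emeasurable_sum => [k s _ _|k _]; [exact: sojourn_flow_ge0|exact: measurable_sojourn_flow].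
- by move=> s; apply: erestrict_ge0 => ? _; rewrite lee_fin path_flow_ge0.
- by move=> s; apply: nneseries_ge0 => k _ _; exact: sojourn_flow_ge0.
have : {ae (@lebesgue_measure R), forall s, forall k, s != t k}.
  apply: ae_foralln => k; exists [set t k]; split => //.
  - exact: lebesgue_measure_set1.
  - by move=> s /= /negP/negPn/eqP.
move=> [N [mN N0 NP]]; exists N; split => //; apply: subset_trans NP => s /= h sT.
apply: h; rewrite patchE mem_setE in_itv/= andbT.
case: ifPn => s0; last by apply: nneseries_ge0 => k _ _; exact: sojourn_flow_ge0.
have [n /andP[ns sn]] := sojourn_ex s0.
apply: le_trans (le_nneseries_term n (fun k => sojourn_flow_ge0 k s)).
by rewrite sojourn_flowE sn andbT lt_neqAle eq_sym sT ns.
Qed.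

Lemma stationary_path_cost_le :
  path_cost T Z q alpha p w <= \sum_(k <oo) sojourn_cost q alpha T Z p k w.
Proof.
rewrite path_costE; under eq_eseriesr do rewrite sojourn_cost_decomposition.
rewrite nneseriesD//; last 2 first.
- by move=> k _ _; apply: integral_ge0 => u _; rewrite lee_fin running_flow_ge0.
- by move=> k _ _; exact: starting_ge0.
by apply: leeD; [exact: stationary_running_le|exact: stationary_esum_le].
Qed.

End stationary_path.
End path.

(** * The value function *)

Lemma nneseries_bounded_below (R : realType) (f : nat -> \bar R) (e : R) :
  0 < e -> (forall k, e%:E <= f k)%E -> (\sum_(k <oo) f k = +oo)%E.
Proof.
move=> e0 ef; apply: eq_infty => r.
have f0 k : (0 <= f k)%E by apply: le_trans (ef k); rewrite lee_fin ltW.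
rewrite (nneseries_split 0 (Num.trunc (r / e)).+1 (fun k _ => f0 k)).
apply: (@le_trans _ _ (\sum_(0 <= k < (Num.trunc (r / e)).+1) e%:E)%E).
  rewrite big_mkord sumEFin lee_fin sumr_const card_ord -mulr_natr mulrC.
  by rewrite -ler_pdivrMr// ltW// truncnS_gt.
by rewrite add0n -[leLHS]adde0 leeD ?lee_sum// nneseries_ge0.
Qed.

Lemma affine_le (R : realType) (a b e x : R) : 0 <= a -> 0 <= b -> 0 <= e -> 0 <= x ->
  a + (b * x + e) <= (a + b + e) * (x + 1).
Proof. by move=> a0 b0 e0 x0; nra. Qed.

Section value.
Context (R : realType) (q : queue R) (alpha : R).
Hypothesis alpha_gt0 : 0 < alpha.
Local Notation lambda := (arr_rate q).
Local Notation mu := (srv_rate q).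
Local Notation h := (hold_cost q).
Local Notation c := (run_cost q).
Local Notation s1 := (start_cost q).

Let l0 := arr_rate_gt0 q.
Let m0 := srv_rate_gt0 q.
Let h0 := hold_cost_gt0 q.
Let c0 := run_cost_gt0 q.
Let s0 := start_cost_ge0 q.

(** The discounted cost with the system on forever, where [i] customers present at time 0
    leave at rate [mu] each, and the expected number of later customers present at time [t] is
    [lambda / mu * (1 - exp (- mu t))]. *)
Definition on_value (i : nat) : R :=
  h * i%:R / (mu + alpha) + h * lambda / (alpha * (mu + alpha)) + c / alpha.

(** The cost rate saved by waiting: [alpha * (s1 + on_value i)] minus the
    holding cost rate and minus [lambda * (on_value i.+1 - on_value i)]. *)
Definition waiting_gain (i : nat) : R := alpha * s1 + c - h * i%:R * mu / (mu + alpha).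

(** While the system is off, the [k]-th arrival has expected discount
    factor [(lambda / (alpha + lambda)) ^ k]. The sum is finite because the gain is positive below
    the threshold only. *)
Definition waiting_value (i : nat) : R :=
  \sum_(k < (Num.trunc (threshold q alpha)).+1)
    (lambda / (alpha + lambda)) ^+ k * (Num.max 0 (waiting_gain (i + k)) / (alpha + lambda)).

Definition value (z : state) : R :=
  if z.2 then on_value z.1 else s1 + on_value z.1 - waiting_value z.1.

Lemma ma_gt0 : 0 < mu + alpha. Proof. exact: addr_gt0. Qed.
Lemma al_gt0 : 0 < alpha + lambda. Proof. exact: addr_gt0. Qed.

Lemma waiting_gainE i :
  waiting_gain i = h * mu / (mu + alpha) * (threshold q alpha - i%:R).
Proof.
have h1 : h != 0 by rewrite gt_eqF. have m1 : mu != 0 by rewrite gt_eqF.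
have ma1 : mu + alpha != 0 by rewrite gt_eqF// ma_gt0.
rewrite /waiting_gain /threshold; move: m1 h1 ma1.
move: (hold_cost q) (srv_rate q) (run_cost q) (start_cost q) (i%:R : R) alpha => H m C S x a m1 h1 ma1.
by field; rewrite m1 h1 ma1.
Qed.

Lemma gain_factor_gt0 : 0 < h * mu / (mu + alpha).
Proof. by rewrite divr_gt0 ?mulr_gt0// ma_gt0. Qed.

Lemma waiting_gain_gt0 i : (0 < waiting_gain i) = (i%:R < threshold q alpha).
Proof. by rewrite waiting_gainE pmulr_rgt0 ?gain_factor_gt0// subr_gt0. Qed.

Lemma waiting_gain_ge0 i : (0 <= waiting_gain i) = (i%:R <= threshold q alpha).
Proof. by rewrite waiting_gainE pmulr_rge0 ?gain_factor_gt0// subr_ge0. Qed.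

Lemma waiting_value_term_ge0 i k :
  0 <= (lambda / (alpha + lambda)) ^+ k * (Num.max 0 (waiting_gain (i + k)) / (alpha + lambda)).
Proof.
rewrite mulr_ge0 ?exprn_ge0 ?divr_ge0 ?le_max ?lexx//; apply: ltW => //; exact: al_gt0.
Qed.

Lemma waiting_value_ge0 i : 0 <= waiting_value i.
Proof. by apply: sumr_ge0 => k _; exact: waiting_value_term_ge0. Qed.

Lemma waiting_value_rec i :
  (alpha + lambda) * waiting_value i =
  Num.max 0 (waiting_gain i) + lambda * waiting_value i.+1.
Proof.
have al1 : alpha + lambda != 0 by rewrite gt_eqF// al_gt0.
rewrite /waiting_value big_ord_recl/= expr0 mul1r addn0 mulrDr.
rewrite [(_ + _) * (_ / _)]mulrC divfK//; congr (_ + _).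
have last0 : Num.max 0 (waiting_gain (i.+1 + Num.trunc (threshold q alpha))) = 0.
  apply/max_idPl; rewrite leNgt waiting_gain_gt0 -leNgt.
  by rewrite (le_trans (ltW (truncnS_gt (threshold q alpha))))// ler_nat addSnnS leq_addl.
rewrite [in RHS]big_ord_recr/= last0 mul0r mulr0 addr0.
rewrite !mulr_sumr; apply: eq_bigr => k _; rewrite /bump/= add1n addSnnS.
rewrite exprS -mulrA mulrA; congr (_ * _).
by rewrite mulrC divfK.
Qed.

Lemma waiting_value_le i : waiting_value i <= s1 + c / alpha.
Proof.
set rho := lambda / (alpha + lambda).
have r0 : 0 <= rho by rewrite divr_ge0// ltW// al_gt0.
have r1 : 1 - rho = alpha / (alpha + lambda).
  rewrite /rho; have := al_gt0; move: alpha lambda => a l al0.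
  by field; rewrite gt_eqF.
pose M := (alpha * s1 + c) / (alpha + lambda).
have M0 : 0 <= M by rewrite divr_ge0 ?addr_ge0 ?mulr_ge0//; apply: ltW => //; exact: al_gt0.
apply: (@le_trans _ _ (\sum_(k < (Num.trunc (threshold q alpha)).+1) rho ^+ k * M)).
  apply: ler_sum => k _; rewrite ler_wpM2l ?exprn_ge0//.
  have asc : 0 <= alpha * s1 + c.
    by rewrite addr_ge0 ?mulr_ge0//; exact: ltW.
  rewrite ler_wpM2r ?invr_ge0 ?(ltW al_gt0)// ge_max asc /=.
  by rewrite /waiting_gain gerBl divr_ge0 ?mulr_ge0// ltW// ma_gt0.
rewrite -mulr_suml; set S := \sum_(k < _) _.
have S1 : (1 - rho) * S <= 1.
  rewrite (_ : (1 - rho) * S = 1 - rho ^+ (Num.trunc (threshold q alpha)).+1).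
    by rewrite gerBl exprn_ge0.
  by rewrite -[1 - rho]opprB mulNr -subrX1 opprB.
have : S <= (alpha + lambda) / alpha.
  by rewrite ler_pdivlMr// mulrC; move: S1; rewrite r1 mulrAC ler_pdivrMr ?al_gt0// mul1r.
move=> SS; apply: (le_trans (ler_wpM2r M0 SS)).
rewrite /M le_eqVlt; apply/orP; left; apply/eqP.
have al1 : alpha + lambda != 0 by rewrite gt_eqF// al_gt0.
have a1 : alpha != 0 by rewrite gt_eqF.
by move: alpha lambda (run_cost q) (start_cost q) al1 a1 => a l C S' al1 a1; field; rewrite a1 al1.
Qed.

Lemma on_value_ge0 i : 0 <= on_value i.
Proof.
have ma := ma_gt0.
by rewrite /on_value !addr_ge0 ?divr_ge0 ?mulr_ge0//; exact: ltW.
Qed.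

Lemma on_value_ge i : c / alpha <= on_value i.
Proof.
have ma := ma_gt0.
by rewrite /on_value lerDr addr_ge0 ?divr_ge0 ?mulr_ge0//; exact: ltW.
Qed.

Lemma on_value_balance i :
  (alpha + lambda + i%:R * mu) * on_value i =
  h * i%:R + c + lambda * on_value i.+1 + i%:R * mu * on_value i.-1.
Proof.
have ma1 : mu + alpha != 0 by rewrite gt_eqF// ma_gt0.
have a1 : alpha != 0 by rewrite gt_eqF.
rewrite /on_value; case: i => [|i].
  rewrite mulr0 !mul0r !addr0 !add0r; move: ma1 a1.
  move: (hold_cost q) (srv_rate q) (run_cost q) (arr_rate q) alpha => H m C l a m1 a1.
  by field; rewrite m1 a1.
rewrite /= -!natr1; move: ma1 a1.
move: (hold_cost q) (srv_rate q) (run_cost q) (arr_rate q) (i%:R : R) alpha => H m C l x a m1 a1.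
by field; rewrite m1 a1.
Qed.

(** The term in parentheses is positive exactly above the threshold, where waiting is
    wrong. *)
Lemma off_value_balance i :
  h * i%:R + lambda * value (i.+1, false) =
  (alpha + lambda) * value (i, false) + (Num.max 0 (waiting_gain i) - waiting_gain i).
Proof.
rewrite /value /= mulrBr (mulrBr (alpha + lambda)) waiting_value_rec.
have ma1 : mu + alpha != 0 by rewrite gt_eqF// ma_gt0.
have a1 : alpha != 0 by rewrite gt_eqF.
rewrite /waiting_gain /on_value -natr1.
move: (waiting_value _) (Num.max _ _) ma1 a1 => D M.
move: (hold_cost q) (srv_rate q) (run_cost q) (arr_rate q) (start_cost q) (i%:R : R) alpha
  => H m C l S x a m1 a1.
by field; rewrite m1 a1.
Qed.

Lemma value_ge0 z : 0 <= value z.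
Proof.
rewrite /value; case: ifP => _; first exact: on_value_ge0.
rewrite subr_ge0 (le_trans (waiting_value_le _))// lerD2l; exact: on_value_ge.
Qed.

Lemma value_subsolution : subsolution q alpha value.
Proof.
split => [z|i|i|i].
- exact: value_ge0.
- by rewrite /value /= gerBl waiting_value_ge0.
- by rewrite off_value_balance lerDl subr_ge0 le_max lexx orbT.
- by rewrite /value /= on_value_balance.
Qed.

Lemma waiting_value_eq0 i : threshold q alpha <= i%:R -> waiting_value i = 0.
Proof.
move=> Ai; apply: big1 => k _; rewrite (_ : Num.max 0 _ = 0) ?mul0r ?mulr0//.
by apply/max_idPl; rewrite leNgt waiting_gain_gt0 -leNgt (le_trans Ai)// ler_nat leq_addr.
Qed.

Lemma waiting_value_gt0 i : i%:R < threshold q alpha -> 0 < waiting_value i.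
Proof.
move=> iA; rewrite /waiting_value big_ord_recl/= expr0 mul1r addn0.
apply: ltr_wpDr; first by apply: sumr_ge0 => k _; exact: waiting_value_term_ge0.
by rewrite divr_gt0 ?al_gt0// lt_max waiting_gain_gt0 iA orbT.
Qed.

(** The value grows at most linearly, so that its discounted expectations tend to 0
    with those of the number of customers. *)
Lemma value_le_count1 : exists2 K, 0 <= K & forall z, value z <= K * count1 R z.
Proof.
have ma := ma_gt0.
pose K1 := h / (mu + alpha).
pose K2 := h * lambda / (alpha * (mu + alpha)) + c / alpha.
have K10 : 0 <= K1 by rewrite divr_ge0// ltW.
have K20 : 0 <= K2 by rewrite addr_ge0// divr_ge0 ?mulr_ge0//; exact: ltW.
have onE i : on_value i = K1 * i%:R + K2.
  by rewrite /on_value /K1 /K2 addrA mulrAC.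
exists (s1 + K1 + K2); first by apply: addr_ge0 => //; exact: addr_ge0.
move=> [i a]; apply: (@le_trans _ _ (s1 + on_value i)).
  rewrite /value /=; case: a; first by rewrite lerDr.
  by rewrite gerBl waiting_value_ge0.
by rewrite onE /count1 /= -natr1; apply: affine_le.
Qed.

Lemma flow_rate_on (phi : state -> bool) n (hs : hist R n) (s : R) i : last_state hs = (i, true) ->
  phi (i, true) ->
  flow_rate q (stationary phi) (@cost_rate R q alpha (stationary phi) n)
    (@start_payment R q (stationary phi) value n) hs s =
  (alpha + sojourn_rate q (stationary phi) hs s) * value (last_state hs).
Proof.
move=> zE on; rewrite /flow_rate /sojourn_rate exit_rateE /cost_rate /start_payment.
rewrite /stationary /= zE /= on /switched_on zE /= !mulr0 !addr0 mulr1 !mul1r.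
by rewrite (addrA alpha) /value /= on_value_balance.
Qed.

(** Starting at once costs [waiting_value i] more than the optimum. *)
Lemma flow_rate_start (phi : state -> bool) n (hs : hist R n) (s : R) i : 0 < s -> last_state hs = (i, false) ->
  phi (i, false) ->
  flow_rate q (stationary phi) (@cost_rate R q alpha (stationary phi) n)
    (@start_payment R q (stationary phi) value n) hs s =
  (alpha + sojourn_rate q (stationary phi) hs s) * (value (last_state hs) + waiting_value i).
Proof.
move=> s_gt0 zE on; rewrite /flow_rate /sojourn_rate exit_rateE /cost_rate /start_payment.
have -> : switched_on (stationary phi) hs s.
  by rewrite /switched_on zE/=; apply/asboolP; exists s; split => //; rewrite /stationary zE.
rewrite /stationary /= zE /= on /= !mulr1 !mul1r (addrA alpha) /value /= subrK.
rewrite [RHS]mulrDr on_value_balance.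
by move: (on_value _) (on_value _) => a b; ring.
Qed.

Lemma flow_rate_wait (phi : state -> bool) n (hs : hist R n) (s : R) i : last_state hs = (i, false) ->
  phi (i, false) = false ->
  flow_rate q (stationary phi) (@cost_rate R q alpha (stationary phi) n)
    (@start_payment R q (stationary phi) value n) hs s =
  (alpha + sojourn_rate q (stationary phi) hs s) * value (last_state hs) +
    (Num.max 0 (waiting_gain i) - waiting_gain i).
Proof.
move=> zE off; rewrite /flow_rate /sojourn_rate exit_rateE /cost_rate /start_payment.
have -> : switched_on (stationary phi) hs s = false.
  apply/negbTE; rewrite /switched_on zE/=; apply/asboolPn => -[v [_ _]].
  by rewrite /stationary zE off.
rewrite /stationary /= zE /= off /= !mulr0 !mul0r !addr0.
by rewrite off_value_balance.
Qed.

End value.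

Lemma stationary_policy (R : realType) (phi : state -> bool) :
  is_policy (stationary (R := R) phi).
Proof.
split => [n|n h s _]; last by near=> u.
apply: (@measurable_state_family _ _ _ _ (fun x : hist R n * R => last_state x.1)
  (fun z _ => phi z)) => //.
exact: measurableT_comp (@measurable_last_state R n) measurable_fst.
Unshelve. all: by end_near. Qed.

(** Any history that ends in [(i, true)] will do. *)
Lemma stationary_never_off_on (R : realType) (phi : state -> bool) :
  never_off (stationary (R := R) phi) -> forall i, phi (i, true).
Proof.
move=> phi_on i.
pose h : hist R 0 := [tuple ((0 : R), (i, true))].
by have := phi_on 0%N h 1 ltr01 isT; rewrite /stationary.
Qed.

(** * Optimality *)

Section optimality.
Context (R : realType) (q : queue R) (alpha : R)
  (d : measure_display) (Omega : measurableType d)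
  (T : nat -> Omega -> R) (Z : nat -> Omega -> state)
  (P : policy R -> state -> probability Omega R).
Hypothesis alpha_gt0 : 0 < alpha.
Hypothesis mT : forall n, measurable_fun setT (T n).
Hypothesis mZ : forall n, measurable_fun setT (Z n).
Hypothesis PT : forall p z, is_policy p -> policy_law T Z q p z (P p z).
Local Notation W := (value q alpha).
Local Open Scope ereal_scope.

Lemma path_regular_ae p z : is_policy p ->
  {ae P p z, forall w, T 0%N w = 0%R /\ forall n, (T n w < T n.+1 w)%R /\
    (Z n.+1 w).2 = p n (history T Z n w) (T n.+1 w - T n w)%R}.
Proof.
move=> pol; have law := PT z pol.
have [N [mN N0 NP]] := initial_ae mT mZ law.
have [M [mM M0 MP]] := ae_foralln (jumps_ae mT mZ pol law).
exists (N `|` M); split.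
- exact: measurableU.
- by rewrite measureU0.
- move=> w /= hw; apply: contrapT => /not_orP[Nw Mw]; apply: hw.
  have [T0 _] : T 0%N w = 0%R /\ Z 0%N w = z by apply: contrapT => /NP.
  by split => //; apply: contrapT => /MP.
Qed.

Lemma discounted_value_cvg0 p z : is_policy p ->
  \int[P p z]_w discounted_value alpha T Z W n w @[n --> \oo] --> 0.
Proof.
move=> pol; have law := PT z pol.
have [K K0 KP] := value_le_count1 q alpha_gt0.
have c0 := discounted_count1_cvg0 mT mZ pol law alpha_gt0.
have Kc : K%:E * \int[P p z]_w discounted_value alpha T Z (@count1 R) n w @[n --> \oo] --> 0.
  by rewrite -(mule0 K%:E); apply: cvgeZl.
apply: (squeeze_cvge _ (cvg_cst 0) Kc); near=> n; apply/andP; split.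
  by apply: integral_ge0 => w _; apply: discounted_value_ge0; exact: value_ge0.
rewrite -ge0_integralZl//; last 2 first.
- exact: measurable_discounted_value.
- by move=> w _; apply: discounted_value_ge0 => z'; rewrite /count1.
apply: ge0_le_integral_in => w _.
  by apply: discounted_value_ge0; exact: value_ge0.
rewrite /discounted_value -EFinM lee_fin mulrCA ler_wpM2l ?expR_ge0//; exact: KP.
Unshelve. all: by end_near. Qed.

Lemma path_cost_ge0 p w : 0 <= path_cost T Z q alpha p w.
Proof.
rewrite adde_ge0//.
  apply: integral_ge0 => s _; rewrite lee_fin mulr_ge0 ?expR_ge0// addr_ge0// mulr_ge0//.
    exact/ltW/hold_cost_gt0.
  exact/ltW/run_cost_gt0.
apply: esum_ge0 => s _; rewrite lee_fin mulr_ge0 ?expR_ge0// /switch_cost.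
by case: ifP => _; [exact: start_cost_ge0|exact: shut_cost_ge0].
Qed.

Lemma cost_upto_le_integral p z n : is_policy p ->
  (forall t : R, (0 <= t)%R ->
    {ae P p z, forall w, finite_set (switchings T Z p w `&` `[0%R, t])}) ->
  \int[P p z]_w cost_upto q alpha T Z p n w <= \int[P p z]_w path_cost T Z q alpha p w.
Proof.
move=> pol fin.
have [N [mN N0 NP]] := path_regular_ae z pol.
have [M [mM M0 MP]] := ae_foralln (fun k : nat => fin k%:R (ler0n _ k)).
apply: ae_ge0_le_integral_measl.
- exact: measurable_cost_upto.
- by move=> w; exact: cost_upto_ge0.
- by move=> w; exact: path_cost_ge0.
exists (N `|` M); split; [exact: measurableU|by rewrite measureU0|].
move=> w /= hw; apply: contrapT => /not_orP[Nw Mw]; apply: hw.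
have [T0 Tw] : T 0%N w = 0%R /\ forall n, (T n w < T n.+1 w)%R /\
    (Z n.+1 w).2 = p n (history T Z n w) (T n.+1 w - T n w)%R.
  by apply: contrapT => /NP.
have finw k : finite_set (switchings T Z p w `&` `[0%R, k%:R]).
  move: k; apply: contrapT => h; apply: Mw; apply: MP; exact: h.
apply: (@cost_upto_le_path_cost _ q alpha _ _ T Z p w pol alpha_gt0 T0) => [k|k|k].
- exact: (Tw k).1.
- exact: (Tw k).2.
apply: sub_finite_set (finw (Num.trunc (T k w)).+1) => s [sws].
rewrite /= !in_itv/= => /andP[s0 sT]; split => //; rewrite s0/=.
by rewrite (le_trans sT)// ltW// truncnS_gt.
Qed.

(** The lower bounds after [n] sojourns are nondecreasing in [n] while the discounted
    value at the [n]-th epoch vanishes, so that the bound from the first step persists.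
    When infinitely many switchings are possible the cost is infinite by definition. *)
Lemma never_off_lower_bound p z (u : state -> R) : is_policy p -> never_off p ->
  (forall z, (0 <= u z)%R) ->
  (forall (h : hist R 0) s, (0 < s)%R ->
    ((alpha + sojourn_rate q p h s) * u (last_state h) <=
     flow_rate q p (@cost_rate R q alpha p 0) (@start_payment R q p W 0) h s)%R) ->
  (u z)%:E <= discounted_cost T Z P q alpha p z.
Proof.
move=> pol poff u0 uW; rewrite /discounted_cost; case: asboolP => [fin|_]; last exact: leey.
set V := \int[P p z]_w path_cost T Z q alpha p w.
have V0 : 0 <= V by apply: integral_ge0 => w _; exact: path_cost_ge0.
have step n : (u z)%:E <= V + \int[P p z]_w discounted_value alpha T Z W n.+1 w.
  have := first_step_lower_bound mT mZ pol (PT z pol) alpha_gt0 n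
    (value_subsolution q alpha_gt0) poff u0 uW.
  by move=> /le_trans; apply; rewrite leeD2r// cost_upto_le_integral.
have cv : V + \int[P p z]_w discounted_value alpha T Z W n.+1 w @[n --> \oo] --> V + 0.
  apply: cvgeD; [by rewrite fin_num_adde_defl|exact: cvg_cst|].
  have := discounted_value_cvg0 z pol.
  by rewrite -(cvg_shiftS (fun n => \int[P p z]_w discounted_value alpha T Z W n w)).
rewrite -(adde0 V) -(cvg_lim _ cv)//; apply: lime_ge; first by apply/cvg_ex; eexists; exact: cv.
by near=> n; exact: step.
Unshelve. all: by end_near. Qed.

Lemma never_off_cost_ge_value p z : is_policy p -> never_off p ->
  (W z)%:E <= discounted_cost T Z P q alpha p z.
Proof.
move=> pol poff; apply: never_off_lower_bound => //; first exact: value_ge0.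
by move=> h s s0; apply: subsolution_flow => //; exact: value_subsolution.
Qed.

Definition threshold_rule (phi : state -> bool) := forall i : nat,
  (threshold q alpha < i%:R -> phi (i, false) = true)%R /\
  (i%:R < threshold q alpha -> phi (i, false) = false)%R.

Lemma threshold_flow phi n (h : hist R n) (s : R) :
  never_off (stationary (R := R) phi) -> threshold_rule phi -> (0 < s)%R ->
  (flow_rate q (stationary phi) (@cost_rate R q alpha (stationary phi) n)
    (@start_payment R q (stationary phi) W n) h s =
  (alpha + sojourn_rate q (stationary phi) h s) * W (last_state h))%R.
Proof.
move=> phi_off rule s0; case zE : (last_state h) => [i []].
  by rewrite -zE (flow_rate_on q alpha_gt0 _ zE)//; exact: (stationary_never_off_on phi_off).
rewrite -zE; case on : (phi (i, false)).
  rewrite (flow_rate_start q alpha_gt0 s0 zE on) waiting_value_eq0 ?addr0//.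
  by rewrite leNgt; apply/negP => /(rule i).2; rewrite on.
rewrite (flow_rate_wait q alpha_gt0 _ zE on) (_ : Num.max 0 _ = waiting_gain q alpha i)%R.
  by rewrite subrr addr0.
apply/max_idPr; rewrite waiting_gain_ge0// leNgt; apply/negP => /(rule i).1.
by rewrite on.
Qed.

Lemma threshold_cost_le_value phi z :
  never_off (stationary (R := R) phi) -> threshold_rule phi ->
  discounted_cost T Z P q alpha (stationary phi) z <= (W z)%:E.
Proof.
move=> poff rule; have pol := stationary_policy R phi.
have law := PT z pol.
have [N [mN N0 NP]] := path_regular_ae z pol.
have [M [mM M0 MP]] := series_discount_finite_ae mT mZ pol law alpha_gt0.
pose NM := N `|` M.
have mNM : measurable NM by exact: measurableU.
have NM0 : P (stationary phi) z NM = 0 by rewrite measureU0.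
have reg w : ~ NM w -> [/\ T 0%N w = 0%R, forall n, (T n w < T n.+1 w)%R,
    forall n, (Z n.+1 w).2 = stationary phi (history T Z n w) (T n.+1 w - T n w)%R &
    forall s, exists n, (s < T n w)%R].
  move=> /not_orP[Nw Mw].
  have [T0 Tw] : T 0%N w = 0%R /\ forall n, (T n w < T n.+1 w)%R /\
      (Z n.+1 w).2 = stationary phi (history T Z n w) (T n.+1 w - T n w)%R.
    by apply: contrapT => /NP.
  have fin : \sum_(k <oo) (expR (- (alpha * T k w)))%:E < +oo by apply: contrapT => /MP.
  split => [//|n|n|s]; [exact: (Tw n).1|exact: (Tw n).2|].
  apply: contrapT => no; move: fin.
  rewrite (@nneseries_bounded_below _ _ (expR (- (alpha * s)))) ?expR_gt0 ?ltxx// => k.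
  rewrite lee_fin ler_expR lerN2 ler_wpM2l ?(ltW alpha_gt0)// leNgt.
  by apply/negP => sT; apply: no; exists k.
have phi_on := stationary_never_off_on poff.
have stat n (h : hist R n) u : stationary phi h u = phi (last_state h) by [].
have fin (t : R) : (0 <= t)%R ->
    {ae P (stationary phi) z, forall w, finite_set (switchings T Z (stationary phi) w `&` `[0%R, t])}.
  move=> _; exists NM; split => // w /= hw; apply: contrapT => /reg[T0 Tlt Zact Toff]; apply: hw.
  exact: (stationary_finite_switchings T0 Tlt Zact stat phi_on Toff).
rewrite /discounted_cost; case: asboolP => [_|//].
apply: (@le_trans _ _ (\int[P (stationary phi) z]_w
    \sum_(k <oo) sojourn_cost q alpha T Z (stationary phi) k w)).
  apply: ae_ge0_le_integral_measr.
  - apply: ge0_emeasurable_sum => [k w _ _|k _]; first exact: sojourn_cost_ge0.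
    exact: measurable_sojourn_cost.
  - by move=> w; exact: path_cost_ge0.
  - by move=> w; apply: nneseries_ge0 => k _ _; exact: sojourn_cost_ge0.
  exists NM; split => // w /= hw; apply: contrapT => /reg[T0 Tlt Zact Toff]; apply: hw.
  exact: (stationary_path_cost_le q pol alpha_gt0 T0 Tlt Zact stat phi_on Toff).
rewrite integral_nneseries//; last 2 first.
- by move=> k; exact: measurable_sojourn_cost.
- by move=> k w _; exact: sojourn_cost_ge0.
apply: lime_le.
  by apply: is_cvg_nneseries => k _ _; apply: integral_ge0 => w _; exact: sojourn_cost_ge0.
near=> n.
have := @cost_upto_upper_bound _ q alpha _ _ T Z mT mZ (stationary phi) z
  (P (stationary phi) z) pol law alpha_gt0 W n (value_ge0 q alpha_gt0).
move=> H; apply: le_trans (H _); last first.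
  by move=> m h s s0; rewrite threshold_flow.
rewrite big_mkord -(@ge0_integral_sum _ _ _ (P (stationary phi) z) setT measurableT 'I_n
  (fun k w => sojourn_cost q alpha T Z (stationary phi) k w))//; last 2 first.
- by move=> k; exact: measurable_sojourn_cost.
- by move=> k w _; exact: sojourn_cost_ge0.
rewrite leeDl//; apply: integral_ge0 => w _; apply: discounted_value_ge0.
exact: value_ge0.
Unshelve. all: by end_near. Qed.

Lemma threshold_rule_optimal phi :
  never_off (stationary (R := R) phi) -> threshold_rule phi ->
  never_off_optimal T Z P q alpha (stationary phi).
Proof.
move=> poff rule; split; [exact: stationary_policy|exact: poff|move=> z].
apply/eqP; rewrite eq_le; apply/andP; split; last first.
  by apply: ereal_inf_lbound; exists (stationary phi) => //; split => //; exact: stationary_policy.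
apply: (le_trans (threshold_cost_le_value z poff rule)).
apply: le_ereal_inf_tmp => _ [p [pol poff'] <-]; exact: never_off_cost_ge_value.
Qed.

Lemma never_off_value_le z : never_off_value T Z P q alpha z <= (W z)%:E.
Proof.
(* one of the threshold policies, to see that the value is attained *)
pose phi (z : state) := z.2 || (threshold q alpha < z.1%:R)%R.
have poff : never_off (stationary (R := R) phi).
  by move=> n h s _ on; rewrite /stationary /phi on.
have rule : threshold_rule phi.
  move=> i; split => [Ai|iA]; rewrite /phi/=; first by rewrite Ai.
  by apply/negbTE; rewrite -leNgt ltW.
apply: le_trans (threshold_cost_le_value z poff rule).
by apply: ereal_inf_lbound; exists (stationary phi) => //; split => //; exact: stationary_policy.
Qed.

(** If in [(i, false)] the Bellman inequality leaves room for a value larger by [e], then the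
    cost from this state exceeds the value by [e], whereas an optimal policy attains the
    value. *)
Lemma wrong_decision_not_optimal phi i (e : R) : never_off (stationary (R := R) phi) ->
  never_off_optimal T Z P q alpha (stationary phi) -> (0 < e)%R ->
  (forall (h : hist R 0) s, (0 < s)%R -> last_state h = (i, false) ->
    ((alpha + sojourn_rate q (stationary phi) h s) * (W (i, false) + e) <=
     flow_rate q (stationary phi) (@cost_rate R q alpha (stationary phi) 0)
       (@start_payment R q (stationary phi) W 0) h s)%R) -> False.
Proof.
move=> poff [_ _ opt] e0 flow; have pol := stationary_policy R phi.
pose u z := (if z == (i, false) then W (i, false) + e else W z)%R.
have W0 := value_ge0 q alpha_gt0.
have u0 z : (0 <= u z)%R.
  by rewrite /u; case: ifP => _ //; rewrite addr_ge0// ltW.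
have : (u (i, false))%:E <= (W (i, false))%:E.
  apply: le_trans (never_off_value_le (i, false)); rewrite -opt.
  apply: never_off_lower_bound => // h s s0; rewrite /u.
  case: eqP => [zE|_]; first exact: flow.
  by apply: subsolution_flow => //; exact: value_subsolution.
by rewrite /u eqxx lee_fin gerDl leNgt e0.
Qed.

Lemma optimal_threshold_rule phi : never_off (stationary (R := R) phi) ->
  never_off_optimal T Z P q alpha (stationary phi) -> threshold_rule phi.
Proof.
move=> poff opt i; split => [Ai|iA].
  apply/negPn/negP => /negbTE off.
  have gain0 : (waiting_gain q alpha i < 0)%R.
    by rewrite ltNge waiting_gain_ge0// -ltNge.
  have al0 : (0 < alpha + arr_rate q)%R by rewrite addr_gt0// arr_rate_gt0.
  (* the excess of off_value_balance, divided by the total rate while off *)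
  apply: (wrong_decision_not_optimal (i := i)
    (e := (- waiting_gain q alpha i / (alpha + arr_rate q))%R) poff opt).
    by rewrite divr_gt0// oppr_gt0.
  move=> h s s0 zE; rewrite (flow_rate_wait q alpha_gt0 _ zE off) zE mulrDr lerD2l.
  rewrite /sojourn_rate exit_rateE /stationary zE off/= !mul0r addr0.
  rewrite mulrC divfK ?gt_eqF//; rewrite lerDr le_max lexx//.
apply/negP => on.
apply: (wrong_decision_not_optimal (i := i) (e := waiting_value q alpha i) poff opt).
  exact: waiting_value_gt0.
by move=> h s s0 zE; rewrite (flow_rate_start q alpha_gt0 s0 zE on) zE.
Qed.

End optimality.

Theorem theorem3 (R : realType) (q : queue R) (alpha : R)
  (d : measure_display) (Omega : measurableType d)
  (T : nat -> Omega -> R) (Z : nat -> Omega -> state)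
  (P : policy R -> state -> probability Omega R)
  (alpha_gt0 : 0 < alpha)
  (mT : forall n, measurable_fun setT (T n))
  (mZ : forall n, measurable_fun setT (Z n))
  (PT : forall p z, is_policy p -> policy_law T Z q p z (P p z))
  (phi : state -> bool)
  (phi_on : never_off (stationary (R := R) phi)) :
  never_off_optimal T Z P q alpha (stationary (R := R) phi) <->
  forall i : nat,
    (threshold q alpha < i%:R -> phi (i, false) = true) /\
    (i%:R < threshold q alpha -> phi (i, false) = false).
Proof.
split; first exact: (optimal_threshold_rule alpha_gt0 mT mZ PT phi_on).
exact: (threshold_rule_optimal alpha_gt0 mT mZ PT phi_on).
Qed.
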